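(* WPQSym is a Hopf subalgebra of WCQSym. Explicitly, for every weak composition $\alpha$, $$\Delta(K_\alpha)=\sum_{\beta|\gamma=\alpha}K_\beta\otimes K_\gamma,\qquad \varepsilon(K_\alpha)=\delta_{\alpha,\emptyset},\qquad S(K_\alpha)=(-1)^{\|\alpha\|}K_{\alpha^t}.$$
   Context: $\mathbb{N}=\{0,1,2,\dots\}$, $\mathbb{P}=\{1,2,\dots\}$, $[m,n]=\{m,\dots,n\}$. A weak composition is a finite (possibly empty) sequence of nonnegative integers; a composition is one with all entries positive. Every weak composition is uniquely $\alpha=(0^{i_1},s_1,\dots,0^{i_k},s_k,0^{i_{k+1}})$ with $i_p\in\mathbb{N}$, $s_q\in\mathbb{P}$ ($0^i$ = $i$ consecutive zeros). $\ell_0(\alpha)=\sum i_p$, $|\alpha|=\sum s_q$, $\|\alpha\|=|\alpha|+\ell_0(\alpha)$. $\mathbb{Z}[[x_1,x_2,\dots]]_{\mathbb{N}}$: formal power series whose monomials are finite products $\prod_{i\in I}x_i^{a_i}$ ($a_i\in\mathbb{N}$), where $x_i^0$ is a formal symbol distinct from $1$ and $x_i^ax_i^b=x_i^{a+b}$. For $\alpha=(a_1,\dots,a_r)$, $M_\alpha=\sum_{1\le i_1<\dots<i_r}x_{i_1}^{a_1}\cdots x_{i_r}^{a_r}$, $M_\emptyset=1$. WCQSym is the $\mathbb{Z}$-span of the $M_\alpha$ (a ring with basis $\{M_\alpha\}$); it is a Hopf algebra with coproduct $\Delta(M_\alpha)=\sum_{\beta\gamma=\alpha}M_\beta\otimes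 M_\gamma$ (sum over all ways of writing $\alpha$ as a concatenation $\beta\gamma$, including empty pieces), counit $\varepsilon(M_\alpha)=\delta_{\alpha,\emptyset}$ and antipode $S$. Enriched partitions: order $\mathbb{Z}\setminus\{0\}$ by $-1\prec1\prec-2\prec2\prec\cdots$. For a labeled poset (partial order $<_P$ on a finite $P\subset\mathbb{P}$), an enriched $P$-partition is $f:P\to\mathbb{Z}\setminus\{0\}$ with, for all $x<_Py$: $f(x)\preceq f(y)$; $f(x)=f(y)>0\Rightarrow x<y$; $f(x)=f(y)<0\Rightarrow x>y$. For $S\subseteq P$, $\Lambda(P,S)=\sum_f\prod_{v\in P}x_{|f(v)|}^{\delta_v}$, $\delta_v=1$ if $v\in S$, else $0$. $P_\alpha$ is the chain on $[1,\|\alpha\|]$ of shape $C_1\oplus P_1\oplus\cdots\oplus C_k\oplus P_k\oplus C_{k+1}$ with $|C_p|=i_p$, $|P_q|=s_q$, where $C_1,\dots,C_{k+1}$ (in order, increasing along the chain) get labels $1,\dots,\ell_0(\alpha)$ and then $P_k,P_{k-1},\dots,P_1$ (in order, increasing along the chain inside each block) get labels $\ell_0(\alpha)+1,\dots,\|\alpha\|$. $K_\alpha=\Lambda(P_\alpha,P_1\cup\dots\cup P_k)$, $K_\emptyset=1$. WPQSym is the $\mathbb{Z}$-span of all $K_\alpha$. Operations: for $\alpha=(a_1,\dots,a_r)$, $\beta=(b_1,\dots,b_s)$, concatenation $\alpha\beta=(a_1,\dots,a_r,b_1,\dots,b_s)$, near concatenation $\alpha\vee\beta=(a_1,\dots,a_{r-1},a_r+b_1,b_2,\dots,b_s)$.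 Write $\beta|\gamma=\alpha$ if either $\beta\gamma=\alpha$ (with $\beta$ or $\gamma$ possibly empty), or the last part of $\beta$ and the first part of $\gamma$ are both positive and $\beta\vee\gamma=\alpha$. Reverse $\alpha^r=(a_r,\dots,a_1)$. Complement $\alpha^c=(1^{a_1})\bullet(1^{a_2})\bullet\cdots\bullet(1^{a_r})$, where $(1^a)$ is the sequence of $a$ ones if $a>0$ and the sequence $(0)$ if $a=0$, and consecutive blocks are joined by near concatenation if both $a_i,a_{i+1}>0$ and by concatenation otherwise. Transpose $\alpha^t=(\alpha^r)^c$. (E.g. $(2,0,0,1,1,2)^t=(1,3,0,0,1,1)$.) *)

(* Defs.v *)
From HB Require Import structures.
From mathcomp Require Import all_boot all_order all_algebra.
From mathcomp Require Import finmap.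
From mathcomp Require Import boolp classical_sets functions cardinality fsbigop.

Set Implicit Arguments.
Unset Strict Implicit.
Unset Printing Implicit Defensive.

Import Order.TTheory GRing.Theory Num.Theory.

Local Open Scope fset_scope.
Local Open Scope fmap_scope.
Local Open Scope classical_set_scope.
Local Open Scope ring_scope.

(* The finite product of the x_i ^ (a_i), for i in I, is the finite map with
   domain I sending i to a_i; a variable with exponent 0 thus differs from an
   absent variable.  Variables are indexed by nat, and x_0 is never used. *)

Definition monom : Type := {fmap nat -> nat}.
HB.instance Definition _ := Choice.copy monom {fmap nat -> nat}.

Definition mone : monom := [fmap].

Definition mvar (i a : nat) : monom := [fmap].[i <- a].

Definition mmul (m n : monom) : monom :=
  [fmap i : (domf m `|` domf n)%fset =>
     (odflt 0 m.[? val i] + odflt 0 n.[? val i])%N].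

Lemma mmulE (m n : monom) (i : nat) :
  (mmul m n).[? i] = match m.[? i], n.[? i] with
                     | Some a, Some b => Some (a + b)%N
                     | Some a, None => Some a
                     | None, ob => ob
                     end.
Proof.
have domE : (i \in domf (mmul m n)) = (i \in domf m) || (i \in domf n).
  by rewrite /mmul /= in_fsetU.
have [im|] := boolP (i \in domf (mmul m n)).
  rewrite in_fnd ffunE /=; move: im; rewrite domE => /orP.
  by case: (fndP m) => ?; case: (fndP n) => ?; rewrite ?addn0 ?add0n //= => -[].
move=> im; rewrite (not_fnd im); move: im; rewrite domE negb_or.
by move=> /andP[/not_fnd -> /not_fnd ->].
Qed.

Lemma mmulA : associative mmul.
Proof.
move=> m n p; apply/fmapP => i; rewrite !mmulE.
by case: m.[? i] => [a|]; case: n.[? i] => [b|]; case: p.[? i] => [c|] //;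
  rewrite addnA.
Qed.

Lemma mmulC : commutative mmul.
Proof.
move=> m n; apply/fmapP => i; rewrite !mmulE.
by case: m.[? i] => [a|]; case: n.[? i] => [b|] //; rewrite addnC.
Qed.

Lemma mmul1m : left_id mone mmul.
Proof. by move=> m; apply/fmapP => i; rewrite mmulE fnd_fmap0. Qed.

HB.instance Definition _ :=
  Monoid.isComLaw.Build monom mone mmul mmulA mmulC mmul1m.

Definition series : Type := monom -> int.
HB.instance Definition _ := GRing.Zmodule.copy series (monom -> int).

(* Each of these sums has finitely many nonzero terms, by [finite_mdiv]. *)
Definition series_mul (f g : series) : series :=
  fun m => \sum_(p \in [set p : monom * monom | mmul p.1 p.2 = m])
             f p.1 * g p.2.

Definition series_one : series := fun m => (m == mone)%:R.

Definition mdiv (m : monom) : set monom := [set d | exists e, mmul d e = m].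

Lemma finite_mdiv (m : monom) : finite_set (mdiv m).
Proof.
pose N := (\max_(i : domf m) m i)%N.
pose code (d : monom) : {ffun domf m -> option 'I_N.+1} :=
  [ffun i => omap inord d.[? val i]].
have div_fnd d i : mdiv m d ->
    match d.[? i] with
    | Some a => i \in domf m /\ (a <= N)%N
    | None => True
    end.
  case=> e dem; case dE: d.[? i] => [a|] //.
  have: exists2 b, m.[? i] = Some b & (a <= b)%N.
    rewrite -dem mmulE dE; case: e.[? i] => [b|]; last by exists a.
    by exists (a + b)%N; rewrite ?leq_addr.
  case=> b; case: fndP => // im [<-] ab; split=> //.
  exact: leq_trans ab (@leq_bigmax _ (fun j : domf m => m j) [` im]).
have code_inj : {in mdiv m &, injective code}.
  move=> d d' /set_mem dm /set_mem dm' /ffunP E; apply/fmapP => i.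
  have := div_fnd d i dm; have := div_fnd d' i dm'.
  case: (boolP (i \in domf m)) => [im|im].
    have := E [` im]; rewrite !ffunE /=.
    case: d.[? i] => [a|]; case: d'.[? i] => [a'|] //= [eqa] [_ a'N] [_ aN].
    by have := congr1 val eqa; rewrite /= !inordK // => ->.
  by case: d.[? i] => [a|]; case: d'.[? i] => [a'|] // => H1 H2;
    by [case: H1 | case: H2].
by rewrite -(eq_finite_set (inj_card_eq code_inj)).
Qed.

Lemma series_mulE (f g : series) (m : monom) (X : {fset monom}) :
    mdiv m `<=` [set` X] ->
  series_mul f g m =
    \sum_(a <- X) \sum_(b <- X) (mmul a b == m)%:R * (f a * g b).
Proof.
move=> mX; rewrite /series_mul.
pose r := [seq p <- [seq (a, b) | a <- X, b <- X] | mmul p.1 p.2 == m].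
rewrite (fsbigE r) /=; first last.
- move=> [a b] /= abm; rewrite mem_filter /= abm eqxx /=.
  rewrite allpairs_f //; [exact: (mX a (ex_intro _ b abm))|].
  by apply: (mX b); exists a; rewrite mmulC.
- by move=> p /=; rewrite mem_filter => /andP[/eqP].
- by rewrite filter_uniq // allpairs_uniq // => -[? ?] [? ?].
rewrite big_filter_cond big_mkcond big_allpairs /=.
apply: eq_bigr => a _; apply: eq_bigr => b _.
rewrite (_ : ((a, b) \in _) = (mmul a b == m)); last first.
  by apply/idP/eqP => [/set_mem|abm]; [|apply/mem_set].
by rewrite andbb; case: eqP => _; rewrite ?mul1r ?mul0r.
Qed.

Definition divs (m : monom) : {fset monom} := fset_set (mdiv m).

Lemma divsP (m : monom) : mdiv m `<=` [set` divs m].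
Proof. by rewrite fset_setK //; apply: finite_mdiv. Qed.

Lemma mem_divs (m a b : monom) : mmul a b = m -> a \in divs m.
Proof. by move=> abm; apply: (divsP (m := m)); exists b. Qed.

Lemma series_mulC : commutative series_mul.
Proof.
move=> f g; apply/funext => m; rewrite !(series_mulE _ _ (@divsP m)).
rewrite exchange_big; apply: eq_bigr => a _; apply: eq_bigr => b _ /=.
by rewrite mmulC [f b * _]mulrC.
Qed.

Lemma series_mul1 : left_id series_one series_mul.
Proof.
move=> f; apply/funext => m; rewrite (series_mulE _ _ (@divsP m)).
have one_m := mem_divs (mmul1m m); have m_m : m \in divs m.
  by apply: (@mem_divs _ _ mone); rewrite mmulC mmul1m.
rewrite (big_fsetD1 mone) //= [X in _ + X]big1_seq ?addr0; last first.
  move=> a /=; rewrite in_fsetD1 => /andP[/negPf a1 _].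
  by rewrite big1 // => b _; rewrite /series_one a1 mul0r mulr0.
rewrite (big_fsetD1 m) //= big1_seq ?addr0; last first.
  move=> b /=; rewrite in_fsetD1 => /andP[/negPf bm _].
  by rewrite mmul1m bm mul0r.
by rewrite /series_one mmul1m !eqxx !mul1r.
Qed.

Lemma series_mulDl : left_distributive series_mul +%R.
Proof.
move=> f g h; apply/funext => m.
rewrite [RHS](_ : _ = series_mul f h m + series_mul g h m) //.
rewrite !(series_mulE _ _ (@divsP m)) -big_split /=; apply: eq_bigr => a _.
rewrite -big_split /=; apply: eq_bigr => b _.
by rewrite -mulrDr -mulrDl.
Qed.

Lemma series_mul3E (f g h : series) (m : monom) :
  series_mul (series_mul f g) h m =
    \sum_(a <- divs m) \sum_(b <- divs m) \sum_(c <- divs m)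
      (mmul (mmul a b) c == m)%:R * (f a * g b * h c).
Proof.
have sub p c : mmul p c = m -> mdiv p `<=` [set` divs m].
  move=> pcm a [e aep]; apply: (@mem_divs _ _ (mmul e c)).
  by rewrite mmulA aep.
rewrite (series_mulE _ _ (@divsP m)).
transitivity (\sum_(p <- divs m) \sum_(c <- divs m) \sum_(a <- divs m)
    \sum_(b <- divs m) (mmul p c == m)%:R *
      ((mmul a b == p)%:R * (f a * g b * h c))).
  apply: eq_bigr => p _; apply: eq_bigr => c _.
  have [pcm|_] := eqVneq; last first.
    by rewrite mul0r big1 // => a _; rewrite big1 // => b _; rewrite mul0r.
  rewrite mul1r (series_mulE _ _ (sub _ _ pcm)) mulr_suml.
  apply: eq_bigr => a _; rewrite mulr_suml; apply: eq_bigr => b _.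
  by rewrite mul1r -!mulrA.
under eq_bigr => p _ do rewrite exchange_big /=.
rewrite exchange_big /=; apply: eq_bigr => a _.
under eq_bigr => p _ do rewrite exchange_big /=.
rewrite exchange_big /=; apply: eq_bigr => b _.
rewrite exchange_big /=; apply: eq_bigr => c _.
have [abcm|abcm] := eqVneq (mmul (mmul a b) c) m.
  rewrite (big_fsetD1 (mmul a b)) /=; last exact: mem_divs abcm.
  rewrite abcm !eqxx !mul1r big1_seq ?addr0 // => p /=.
  by rewrite in_fsetD1 eq_sym => /andP[/negPf-> _]; rewrite mul0r mulr0.
rewrite mul0r big1 // => p _.
by case: eqVneq => [pcm|_]; case: eqVneq => [abp|_]; rewrite ?(mul0r, mulr0) //;
  rewrite -abp in pcm; rewrite pcm eqxx in abcm.
Qed.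

Lemma series_mulA : associative series_mul.
Proof.
move=> f g h; rewrite series_mulC; apply/funext => m; rewrite !series_mul3E.
under eq_bigr => a _ do rewrite exchange_big /=.
rewrite exchange_big /=; apply: eq_bigr => a _.
apply: eq_bigr => b _; apply: eq_bigr => c _.
by rewrite [mmul _ a]mmulC mmulA [_ * f a]mulrC !mulrA.
Qed.

Lemma series_one_neq0 : series_one != 0 :> series.
Proof. by apply/eqP => /(congr1 (@^~ mone)); rewrite /series_one eqxx. Qed.

HB.instance Definition _ := GRing.Zmodule_isComNzRing.Build series
  series_mulA series_mulC series_mul1 series_mulDl series_one_neq0.

(* Formal sum of the monomials [mu t], for [t] in [A]; it is meaningful when
   every monomial is the value of [mu] at finitely many points of [A]. *)
Definition formal_sum (T : choiceType) (A : set T) (mu : T -> monom) : series :=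
  fun m => \sum_(t \in A) ((m == mu t)%:R : int).

Definition zspan (V : zmodType) (A : set V) : set V :=
  [set x | exists (n : nat) (c : 'I_n -> int) (v : 'I_n -> V),
             (forall i, A (v i)) /\ x = \sum_(i < n) v i *~ c i].

Definition wcomp : Type := seq nat.
HB.instance Definition _ := Choice.copy wcomp (seq nat).

Definition num_zeros (al : wcomp) : nat := count_mem 0%N al.

Definition wnorm (al : wcomp) : nat := (sumn al + num_zeros al)%N.

Definition increasing_idx (r : nat) (i : {ffun 'I_r -> nat}) : Prop :=
  (forall j, (0 < i j)%N) /\ (forall j k : 'I_r, (j < k)%N -> (i j < i k)%N).

Definition wmonom (al : wcomp) (i : {ffun 'I_(size al) -> nat}) : monom :=
  \big[mmul/mone]_(j < size al) mvar (i j) (nth 0%N al j).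

Definition M (al : wcomp) : series :=
  formal_sum [set i | increasing_idx i] (@wmonom al).

Definition WCQSym : set series := zspan (range M).

(* The coordinate of [f] on [M al]: the monomial x_1 ^ a_1 ... x_r ^ a_r occurs
   in [M al], with coefficient 1, and in no other [M be]; see [coord_M]. *)
Definition coord (al : wcomp) (f : series) : int :=
  f (wmonom [ffun j : 'I_(size al) => j.+1]).

(* The additive map sending [M al] to [F al], on WCQSym. *)
Definition linear_ext (V : zmodType) (F : wcomp -> V) (f : series) : V :=
  \sum_(al \in [set: wcomp]) F al *~ coord al f.

Lemma wmonom_fnd (al : wcomp) (i : {ffun 'I_(size al) -> nat}) (k : nat) :
    injective i ->
  (wmonom i).[? k] =
    if [pick j | i j == k] is Some j then Some (nth 0%N al j) else None.
Proof.
move=> inj_i.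
have sum_fnd (s : seq 'I_(size al)) : uniq s ->
    (\big[mmul/mone]_(j <- s) mvar (i j) (nth 0%N al j)).[? k] =
    if [pick j in s | i j == k] is Some j then Some (nth 0%N al j) else None.
  elim: s => [_|j s IHs /= /andP[js /IHs IH]].
    by rewrite big_nil fnd_fmap0; case: pickP => // j /=.
  rewrite big_cons mmulE IH {IHs IH} /mvar fnd_set fnd_fmap0 eq_sym.
  have [ijk|ijk] := eqVneq (i j) k.
    case: pickP => [l /andP[ls /eqP ilk]|_].
      by move: js; rewrite (inj_i j l) ?ls // ilk.
    case: pickP => [l /andP[_ /eqP ilk]|/(_ j)].
      by rewrite (inj_i j l) // ilk.
    by rewrite /= inE eqxx ijk eqxx.
  case: pickP => [l /andP[ls /eqP ilk]|nos].
    case: pickP => [l' /andP[_ /eqP il'k]|/(_ l)].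
      by rewrite (inj_i l l') // ilk il'k.
    by rewrite /= inE ls orbT ilk eqxx.
  case: pickP => // l /andP[]; rewrite inE => /orP[/eqP->|ls] /eqP ilk.
    by rewrite ilk eqxx in ijk.
  by have := nos l; rewrite /= ls ilk eqxx.
rewrite /wmonom sum_fnd ?index_enum_uniq //.
by congr (if _ is Some j then _ else _); apply: eq_pick => j; rewrite /= mem_index_enum.
Qed.

Lemma increasing_inj (r : nat) (i : {ffun 'I_r -> nat}) :
  increasing_idx i -> injective i.
Proof.
case=> _ incr j k ijk; apply/val_inj.
by case: (ltngtP j k) => // /incr; rewrite ijk ltnn.
Qed.

Lemma increasing_sorted (r : nat) (i : {ffun 'I_r -> nat}) :
  increasing_idx i -> sorted ltn (codom i).
Proof.
case=> _ incr; rewrite /codom sorted_map.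
have : sorted ltn (map val (enum 'I_r)) by rewrite val_enum_ord iota_ltn_sorted.
rewrite sorted_map; apply: sub_sorted => j k /=; exact: incr.
Qed.

Lemma wmonom_inj (al be : wcomp) (i : {ffun 'I_(size al) -> nat})
    (j : {ffun 'I_(size be) -> nat}) :
    increasing_idx i -> increasing_idx j -> wmonom i = wmonom j ->
  al = be /\ codom i = codom j.
Proof.
move=> inc_i inc_j eq_ij.
have inj_i := increasing_inj inc_i; have inj_j := increasing_inj inc_j.
have fndE k := congr1 (fun m : monom => m.[? k]) eq_ij.
have codE : codom i = codom j.
  apply: (irr_sorted_eq ltn_trans ltnn); try exact: increasing_sorted.
  move=> k; have := fndE k; rewrite !wmonom_fnd //.
  case: pickP => [x /eqP <-|nx]; case: pickP => [y /eqP yE|ny] // _.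
  - by rewrite codom_f -yE codom_f.
  - by apply/idP/idP => /codomP[x kE];
      [have := nx x | have := ny x]; rewrite kE eqxx.
split=> //.
have szE : size al = size be.
  by have := congr1 size codE; rewrite !size_codom !card_ord.
apply: (@eq_from_nth _ 0%N) => // k kal.
pose x := Ordinal kal; have kbe : (k < size be)%N by rewrite -szE.
pose y := Ordinal kbe.
have ixy : i x = j y.
  have := congr1 (nth 0%N ^~ k) codE; rewrite /codom /image_mem.
  rewrite (nth_map x) -?enumT ?size_enum_ord //.
  rewrite (nth_map y) -?enumT ?size_enum_ord //.
  by have := nth_ord_enum x x; have := nth_ord_enum y y => /= -> ->.
have := fndE (i x); rewrite !wmonom_fnd //.
case: pickP => [x' /eqP/inj_i ->|/(_ x)]; last by rewrite eqxx.
case: pickP => [y' /eqP|/(_ y)]; last by rewrite /= ixy eqxx.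
by rewrite ixy => /inj_j -> [].
Qed.

Lemma coord_M (al be : wcomp) : coord al (M be) = (al == be)%:R.
Proof.
have std_inc r : increasing_idx [ffun j : 'I_r => j.+1].
  by split=> [j|j k]; rewrite !ffunE.
rewrite /coord /M /formal_sum; have [<-|al_be] := eqVneq al be; last first.
  apply: fsbig1 => i inc_i; case: eqP => // /(wmonom_inj (std_inc _) inc_i)[E].
  by rewrite E eqxx in al_be.
rewrite (fsbigE [:: [ffun j : 'I_(size al) => j.+1]]) //.
- by rewrite big_cons big_nil mem_set //= eqxx addr0.
- by move=> i /=; rewrite inE => /eqP->.
move=> i inc_i; rewrite inE => ni; case: eqP => // E; case/eqP: ni.
have [_ codE] := wmonom_inj (std_inc _) inc_i E.
by apply/ffunP => x; apply/eqP; have /eq_in_map := codE; move/(_ x)=> -> //; rewrite mem_enum.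
Qed.

Lemma linear_ext_M (V : zmodType) (F : wcomp -> V) (al : wcomp) :
  linear_ext F (M al) = F al.
Proof.
rewrite /linear_ext (fsbigE [:: al]) //=.
  by rewrite big_cons big_nil in_setT coord_M eqxx addr0.
by move=> be _; rewrite inE coord_M => /negPf->; rewrite mulr0z.
Qed.

(* WCQSym (x) WCQSym is realized inside the power series in two disjoint sets
   of variables, f (x) g being the function (m, n) |-> f m * g n.  It embeds
   there because, by [coord_M], the products of two elements of the basis M
   are linearly independent. *)

Definition series2 : Type := monom * monom -> int.
HB.instance Definition _ := GRing.Zmodule.copy series2 (monom * monom -> int).

Definition tens (f g : series) : series2 := fun p => f p.1 * g p.2.

Definition tensor_square (H : set series) : set series2 :=
  zspan [set t | exists f g, [/\ H f, H g & t = tens f g]].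

Definition coprod : series -> series2 :=
  linear_ext (fun al =>
    \sum_(i < (size al).+1) tens (M (take i al)) (M (drop i al))).

Definition counit : series -> int :=
  linear_ext (fun al => (al == [::])%:R).

(* The last two clauses are mu (S (x) id) Delta = eta epsilon
   = mu (id (x) S) Delta, in Sweedler form. *)
Record is_antipode (S : series -> series) : Prop := IsAntipode {
  antipode_stable : forall f, WCQSym f -> WCQSym (S f);
  antipodeB : forall f g, WCQSym f -> WCQSym g -> S (f - g) = S f - S g;
  antipode_convl : forall (f : series) (n : nat) (a b : 'I_n -> series),
    WCQSym f -> (forall i, WCQSym (a i)) -> (forall i, WCQSym (b i)) ->
    coprod f = \sum_(i < n) tens (a i) (b i) ->
    \sum_(i < n) S (a i) * b i = (counit f)%:~R;
  antipode_convr : forall (f : series) (n : nat) (a b : 'I_n -> series),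
    WCQSym f -> (forall i, WCQSym (a i)) -> (forall i, WCQSym (b i)) ->
    coprod f = \sum_(i < n) tens (a i) (b i) ->
    \sum_(i < n) a i * S (b i) = (counit f)%:~R
}.

Record hopf_subalgebra (S : series -> series) (H : set series) : Prop :=
  HopfSubalgebra {
    hopf_sub : H `<=` WCQSym;
    hopf1 : H 1;
    hopfB : forall f g, H f -> H g -> H (f - g);
    hopfM : forall f g, H f -> H g -> H (f * g);
    hopf_coprod : forall f, H f -> tensor_square H (coprod f);
    hopf_antipode : forall f, H f -> H (S f)
  }.

(* -1 < 1 < -2 < 2 < ... *)
Definition preceq (y z : int) : bool :=
  (`|y| < `|z|)%N || (`|y|%N == `|z|%N) && (y <= z).

Definition enriched (P : {fset nat}) (ltP : rel nat) (f : {ffun P -> int}) :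
    Prop :=
  (forall x, f x != 0) /\
  (forall x y : P, ltP (val x) (val y) ->
     [/\ preceq (f x) (f y),
         f x = f y -> 0 < f x -> (val x < val y)%N &
         f x = f y -> f x < 0 -> (val y < val x)%N]).

Definition Lambda (P : {fset nat}) (ltP : rel nat) (S : {fset nat}) : series :=
  formal_sum [set f | enriched ltP f]
    (fun f : {ffun P -> int} =>
       \big[mmul/mone]_(v : P) mvar `|f v|%N (val v \in S)).

(* Labels of the chain P_al from bottom to top, where [z] is l_0(al), [c] is
   the label of the next zero part, and the blocks P_q to the right of the
   current one take up the labels z+1, ..., z + sumn al'. *)
Fixpoint chain_labels (z c : nat) (al : wcomp) : seq nat :=
  match al with
  | [::] => [::]
  | 0%N :: al' => c :: chain_labels z c.+1 al'
  | a :: al' => iota (z + sumn al').+1 a ++ chain_labels z c al'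
  end.

Definition chain (al : wcomp) : seq nat := chain_labels (num_zeros al) 1 al.

Definition K (al : wcomp) : series :=
  Lambda [fset x in chain al]
    (fun x y => (index x (chain al) < index y (chain al))%N)
    [fset x in chain al | (num_zeros al < x)%N].

Definition WPQSym : set series := zspan (range K).

(* Only used on nonempty arguments. *)
Definition nearcat (al be : wcomp) : wcomp :=
  take (size al).-1 al ++ (last 0 al + head 0 be)%N :: behead be.

Definition bar_split (al : wcomp) : set (wcomp * wcomp) :=
  [set p | p.1 ++ p.2 = al \/
           [/\ (0 < last 0 p.1)%N, (0 < head 0 p.2)%N & nearcat p.1 p.2 = al]].

Definition compl_block (a : nat) : wcomp :=
  if a is 0%N then [:: 0%N] else nseq a 1%N.

Fixpoint wcompl (al : wcomp) : wcomp :=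
  match al with
  | [::] => [::]
  | a :: al' =>
      if (0 < a)%N && (0 < head 0 al')%N then
        nearcat (compl_block a) (wcompl al')
      else compl_block a ++ wcompl al'
  end.

Definition wtransp (al : wcomp) : wcomp := wcompl (rev al).

(* Main.v *)
(* A chain is encoded as a word w whose letters carry an exponent 0 or 1, with a
   relation telling which pairs of consecutive letters are ascents.  An enriched
   partition cuts w into runs of equal values -1, 1, -2, 2, ..., each run being
   descending or ascending according to the sign of its value.  So in finitely
   many variables K is a product, for the convolution over the cuts w = uv, of
   one elementary factor per value.

   Grouping the values -k and k expands K(w) on the basis M: sum over the
   factorizations of w of a product of coefficients, each depending only on the
   peaks of one factor.  This gives Delta K(w) = sum over w = uv of
   K(u) (x) K(v).  The elementary factors of the values k and -k are, up to
   signs and reversal, convolution inverse to each other, whence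
   S(K(w)) = (-1)^|w| K(reverse of w).

   The elementary factors are characters for the shuffle of words with disjoint
   letters, hence so is K, and K_al K_be is a sum of K(w) over shuffles.  Such a
   w may contain descents between letters of exponent 0, which chains do not
   have; these are removed, starting from the last one, by relations coming from
   x_k^0 x_k^0 = x_k^0. *)

Require Import Defs.
From mathcomp Require Import all_boot all_order all_algebra.
From mathcomp Require Import finmap zify.
From mathcomp Require Import boolp classical_sets functions cardinality fsbigop.

Set Implicit Arguments.
Unset Strict Implicit.
Unset Printing Implicit Defensive.

Import Order.TTheory GRing.Theory Num.Theory.

Local Open Scope classical_set_scope.
Local Open Scope ring_scope.

(** * Deconcatenation of words *)

Section Cuts.

Variables (L : Type) (V : nmodType).
Implicit Types (u v w : seq L) (F : seq L * seq L -> V).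

Fixpoint cuts w : seq (seq L * seq L) :=
  ([::], w) :: if w is a :: w' then [seq (a :: p.1, p.2) | p <- cuts w'] else [::].

Lemma cuts_iota w :
  cuts w = [seq (take i w, drop i w) | i <- iota 0 (size w).+1].
Proof.
elim: w => [|a w IH] //.
rewrite [cuts _]/= IH -map_comp -[(size (a :: w)).+1]/(1 + (size w).+1)%N.
by rewrite iotaD map_cat (iotaDl 1 0) -map_comp.
Qed.

Arguments cuts : simpl never.

Lemma sum_cuts_cons F a w :
  \sum_(p <- cuts (a :: w)) F p =
  F ([::], a :: w) + \sum_(p <- cuts w) F (a :: p.1, p.2).
Proof. by rewrite big_cons big_map. Qed.

(** The cut between [u] and [v] occurs in both sums on the right; it is added on the left because
    [V] has no subtraction. *)
Lemma sum_cuts_cat F u v :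
  \sum_(p <- cuts (u ++ v)) F p + F (u, v) =
  \sum_(p <- cuts u) F (p.1, p.2 ++ v) + \sum_(p <- cuts v) F (u ++ p.1, p.2).
Proof.
elim: u F => [|a u IH] F.
  by rewrite [in RHS]big_seq1 addrC; congr (_ + _); apply: eq_bigr => -[].
rewrite cat_cons !sum_cuts_cons -!addrA; congr (_ + _).
exact: (IH (fun p => F (a :: p.1, p.2))).
Qed.

Lemma sum_cuts_rcons F w a :
  \sum_(p <- cuts (rcons w a)) F p =
  \sum_(p <- cuts w) F (p.1, rcons p.2 a) + F (rcons w a, [::]).
Proof.
elim: w F => [|b w IH] F; first by rewrite big_cons !big_seq1.
rewrite rcons_cons !sum_cuts_cons -!addrA; congr (_ + _).
exact: (IH (fun p => F (b :: p.1, p.2))).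
Qed.

Lemma sum_cuts_rev F w :
  \sum_(p <- cuts (rev w)) F p = \sum_(p <- cuts w) F (rev p.2, rev p.1).
Proof.
elim: w F => [|a w IH] F; first by rewrite !big_seq1.
rewrite rev_cons sum_cuts_rcons sum_cuts_cons rev_cons addrC; congr (_ + _).
rewrite (IH (fun p => F (p.1, rcons p.2 a))).
by apply: eq_bigr => p _; rewrite rev_cons.
Qed.

(** Coassociativity of deconcatenation: both sides run over the factorizations of [w] into three
    pieces. *)
Lemma sum_cuts_assoc (B : seq L -> seq L -> seq L -> V) w :
  \sum_(p <- cuts w) \sum_(q <- cuts p.1) B q.1 q.2 p.2 =
  \sum_(p <- cuts w) \sum_(q <- cuts p.2) B p.1 q.1 q.2.
Proof.
elim: w B => [|a w IH] B; first by rewrite !big_seq1.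
rewrite !sum_cuts_cons big_seq1 /=.
under eq_bigr => p _ do rewrite big_cons big_map.
by rewrite big_split /= (IH (fun x y z => B (a :: x) y z)) addrA.
Qed.

End Cuts.

Arguments cuts : simpl never.

Lemma mem_cuts (L : eqType) (u v w : seq L) : ((u, v) \in cuts w) = (w == u ++ v).
Proof.
elim: w u v => [|a w IH] [|b u] v; rewrite /cuts /= !inE -/(cuts _) //=.
- by rewrite xpair_eqE eq_sym.
- by rewrite xpair_eqE eqxx eq_sym; case: mapP => [[p _ []]|]; rewrite ?orbF.
apply/mapP/eqP => [[[x y] xy [-> -> ->]]|[-> /eqP]].
  by move: xy; rewrite IH => /eqP->.
by rewrite -IH; exists (u, v).
Qed.

Lemma cuts_cat (L : eqType) (w : seq L) p : p \in cuts w -> w = p.1 ++ p.2.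
Proof. by case: p => u v; rewrite mem_cuts => /eqP. Qed.

(** * Convolution over the cuts of a word *)

Section Convolution.

Variables (L : Type) (A : comNzRingType).
Implicit Types (F G H : seq L -> A) (w : seq L).

Definition conv F G w : A := \sum_(p <- cuts w) F p.1 * G p.2.

Definition conv1 w : A := (nilp w)%:R.

Lemma eq_conv F F' G G' : F =1 F' -> G =1 G' -> conv F G =1 conv F' G'.
Proof. by move=> EF EG w; apply: eq_bigr => p _; rewrite EF EG. Qed.

Lemma convA F G H : conv F (conv G H) =1 conv (conv F G) H.
Proof.
move=> w; rewrite /conv; under eq_bigr => p _ do rewrite mulr_sumr.
under [RHS]eq_bigr => p _ do rewrite mulr_suml.
rewrite (sum_cuts_assoc (fun x y z => F x * G y * H z)).
by do 2!apply: eq_bigr => ? _; rewrite mulrA.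
Qed.

Lemma conv1l F : conv conv1 F =1 F.
Proof.
case=> [|a w]; rewrite /conv; first by rewrite big_seq1 mul1r.
rewrite sum_cuts_cons mul1r big1 ?addr0 //.
by move=> p _; rewrite mul0r.
Qed.

Lemma conv1r F : conv F conv1 =1 F.
Proof.
move=> w; elim: w F => [|a w IH] F; rewrite /conv; first by rewrite big_seq1 mulr1.
rewrite sum_cuts_cons mulr0 add0r.
exact: (IH (fun x => F (a :: x))).
Qed.

Definition conv_seq (T : Type) (E : T -> seq L -> A) (s : seq T) : seq L -> A :=
  foldr (fun c => conv (E c)) conv1 s.

Lemma conv_nil F G : F [::] = 1 -> G [::] = 1 -> conv F G [::] = 1.
Proof. by move=> F1 G1; rewrite /conv big_seq1 F1 G1 mulr1. Qed.

Lemma signr_size_cat u v : (-1 : A) ^+ size (u ++ v : seq L) =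
  (-1) ^+ size u * (-1) ^+ size v.
Proof. by rewrite size_cat exprD. Qed.

(* The antipode of the deconcatenation coalgebra, up to complementation of the
   relation between consecutive letters. *)
Definition signed_rev F w : A := (-1) ^+ size w * F (rev w).

End Convolution.

(** Reversal exchanges the two pieces of a cut, and the sign is multiplicative. *)
Lemma signed_rev_conv (L : eqType) (A : comNzRingType) (F G : seq L -> A) :
  signed_rev (conv F G) =1 conv (signed_rev G) (signed_rev F).
Proof.
move=> w; rewrite /signed_rev /conv sum_cuts_rev mulr_sumr.
rewrite big_seq [RHS]big_seq; apply: eq_bigr => p /cuts_cat->.
by rewrite /= signr_size_cat [F (rev _) * _]mulrC mulrACA.
Qed.

(** * Shuffles and shuffle characters *)

Section Shuffle.

Variable L : Type.
Implicit Types u v w : seq L.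

Fixpoint shuffle u : seq L -> seq (seq L) :=
  if u is a :: u' then
    fix shuffle_u v :=
      if v is b :: v' then
        map (cons a) (shuffle u' v) ++ map (cons b) (shuffle_u v')
      else [:: u]
  else fun v => [:: v].

Lemma shufflev0 u : shuffle u [::] = [:: u].
Proof. by case: u. Qed.

Lemma shuffle_cons a u b v :
  shuffle (a :: u) (b :: v) =
  map (cons a) (shuffle u (b :: v)) ++ map (cons b) (shuffle (a :: u) v).
Proof. by []. Qed.

Arguments shuffle : simpl never.

(** Deconcatenation is multiplicative for shuffles: to cut a shuffle of [u] and [v] is to cut [u]
    and [v], then to shuffle the left pieces and the right pieces separately. *)
Lemma sum_shuffle_cuts (V : nmodType) (B : seq L -> seq L -> V) u v :
  \sum_(w <- shuffle u v) \sum_(p <- cuts w) B p.1 p.2 =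
  \sum_(p <- cuts u) \sum_(q <- cuts v)
     \sum_(x <- shuffle p.1 q.1) \sum_(y <- shuffle p.2 q.2) B x y.
Proof.
pose S C := (fun x1 y1 x2 y2 : seq L =>
  \sum_(x <- shuffle x1 y1) \sum_(y <- shuffle x2 y2) C x y : V).
have base C : S C [::] [::] = fun x2 y2 => \sum_(y <- shuffle x2 y2) C [::] y.
  by apply/funext => x2; apply/funext => y2; rewrite /S big_seq1.
(* The induction puts a letter in front of the first argument of [C], hence the quantification over
   [C]. *)
suff: forall C u v, \sum_(w <- shuffle u v) \sum_(p <- cuts w) C p.1 p.2 =
  \sum_(p <- cuts u) \sum_(q <- cuts v) S C p.1 q.1 p.2 q.2 by apply.
move=> {B u v} C u; elim: u C => [|a u IHu] C v.
  rewrite !big_seq1 /S.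
  by apply: eq_bigr => q _; rewrite !big_seq1.
elim: v C => [|b v IHv] C.
  rewrite big_seq1; apply: eq_bigr => q _.
  by rewrite big_seq1 /S !shufflev0 !big_seq1.
rewrite shuffle_cons big_cat !big_map.
under eq_bigr => w _ do rewrite sum_cuts_cons.
rewrite big_split /= (IHu (fun x y => C (a :: x) y)) /=.
under [X in _ + X]eq_bigr => w _ do rewrite sum_cuts_cons.
rewrite big_split /= (IHv (fun x y => C (b :: x) y)) /=.
rewrite addrACA.
rewrite [in RHS]sum_cuts_cons [in RHS]sum_cuts_cons /= base.
under [X in _ + _ = _ + X]eq_bigr => p _ do rewrite sum_cuts_cons.
rewrite big_split /= shuffle_cons big_cat !big_map /= -!addrA; congr (_ + (_ + _)).
under eq_bigr => p _ do rewrite sum_cuts_cons.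
rewrite big_split /=.
rewrite [X in _ + X = _]sum_cuts_cons /=.
rewrite addrACA [X in X + _ = _]addrC -[LHS]addrA; congr (_ + (_ + _)).
  by apply: eq_bigr => q _; rewrite /S !big_seq1.
  by apply: eq_bigr => p _; rewrite /S shufflev0 !big_seq1.
rewrite -big_split /=; apply: eq_bigr => p _.
rewrite -big_split /=; apply: eq_bigr => q _.
by rewrite /S shuffle_cons big_cat !big_map.
Qed.

End Shuffle.

Arguments shuffle : simpl never.

Lemma perm_shuffle (L : eqType) (u v w : seq L) :
  w \in shuffle u v -> perm_eq w (u ++ v).
Proof.
elim: u v w => [|a u IHu] v w; first by rewrite inE => /eqP->.
elim: v w => [|b v IHv] w; first by rewrite inE cats0 => /eqP->.
rewrite shuffle_cons mem_cat => /orP[] /mapP[x xs ->].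
  by rewrite cat_cons perm_cons IHu.
rewrite -[b :: v]cat1s perm_sym perm_catCA /= perm_cons perm_sym.
exact: IHv.
Qed.

Section ShuffleCharacter.

Variables (L : eqType) (A : comNzRingType).
Implicit Types (u v w : seq L) (F G : seq L -> A) (r : rel L).

Definition disjoint_words u v := all (fun x => x \notin v) u.

Definition shuffle_char F :=
  forall u v, disjoint_words u v -> F u * F v = \sum_(w <- shuffle u v) F w.

Lemma disjoint_words_cat u1 u2 v1 v2 :
  disjoint_words (u1 ++ u2) (v1 ++ v2) ->
  disjoint_words u1 v1 /\ disjoint_words u2 v2.
Proof.
rewrite /disjoint_words all_cat => /andP[/allP H1 /allP H2].
split; apply/allP => x xu; [have := H1 x xu | have := H2 x xu];
  by rewrite mem_cat negb_or => /andP[].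
Qed.

Lemma shuffle_char_conv1 : shuffle_char (@conv1 L A).
Proof.
move=> u v _; rewrite (big_nth [::]) /conv1.
case: u => [|a u]; first by rewrite big_nat1 mul1r.
case: v => [|b v]; first by rewrite shufflev0 big_nat1 mul0r.
rewrite mul0r -(big_nth [::] xpredT (fun w => (nilp w)%:R)) big_seq big1 // => w /perm_shuffle/perm_size.
by case: w.
Qed.

(** Characters of a bialgebra with values in a commutative ring are closed under convolution. *)
Lemma shuffle_char_conv F G :
  shuffle_char F -> shuffle_char G -> shuffle_char (conv F G).
Proof.
move=> chF chG u v duv; rewrite (sum_shuffle_cuts (fun x y => F x * G y)).
rewrite mulr_suml; under eq_bigr => p _ do rewrite mulr_sumr.
rewrite big_seq [RHS]big_seq; apply: eq_bigr => p /cuts_cat pu.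
rewrite big_seq [RHS]big_seq; apply: eq_bigr => q /cuts_cat qv.
rewrite mulrACA; move: duv; rewrite pu qv => /disjoint_words_cat[d1 d2].
rewrite chF // chG // mulr_suml; apply: eq_bigr => x _.
by rewrite mulr_sumr.
Qed.

(** Two sorted words without common letters have exactly one sorted shuffle, which starts with the
    smaller of their first letters; and both words are sorted as soon as one of their shuffles
    is. *)
Lemma shuffle_char_sorted r :
    transitive r -> (forall x y, x != y -> r x y = ~~ r y x) ->
  shuffle_char (fun w => (sorted r w)%:R).
Proof.
move=> r_tr r_tot; elim=> [|a u IHu] v; first by rewrite big_seq1 mul1r.
elim: v => [|b v IHv] duv; first by rewrite shufflev0 big_seq1 mulr1.
have ab : a != b.
  by move: duv => /= /andP[]; rewrite inE negb_or => /andP[].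
rewrite shuffle_cons big_cat !big_map /=.
have pathE c w : (path r c w) = all (r c) w && sorted r w.
  exact: path_sortedE.
(* By transitivity, a word that starts with [c] and contains a letter [d] not above [c] is not
   sorted. *)
have zero c s (t : seq (seq L)) d : r c d = false ->
    {in t, forall w, d \in w} -> s = t ->
    \sum_(w <- s) (path r c w)%:R = 0 :> A.
  move=> rcd dt ->; rewrite big_seq big1 // => w /dt dw.
  by rewrite pathE; case: allP => // /(_ _ dw); rewrite rcd.
have [rab|rab] := boolP (r a b).
  rewrite [X in _ + X](zero _ _ _ a _ _ erefl); first last.
  - by move=> w /perm_shuffle/perm_mem->; rewrite mem_cat mem_head.
  - by apply: negbTE; rewrite -r_tot.
  rewrite addr0 !pathE.
  (* That [a] lies below all other letters depends only on which letters occur, so this condition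
     leaves the sum over shuffles. *)
  have Eu : \sum_(w <- shuffle u (b :: v)) (path r a w)%:R =
      (all (r a) u && all (r a) (b :: v))%:R * \sum_(w <- shuffle u (b :: v)) (sorted r w)%:R :> A.
    rewrite mulr_sumr big_seq [RHS]big_seq; apply: eq_bigr => w /perm_shuffle/perm_all E.
    by rewrite pathE E all_cat -natrM mulnb.
  rewrite Eu -IHu; last by move: duv => /= /andP[].
  rewrite -!natrM !mulnb /=; congr (_%:R); rewrite rab pathE /=.
  case: (all (r a) u); rewrite //= ?andbF //=.
  case: (sorted r u); rewrite ?andbF //=.
  have [bv|] := boolP (all (r b) v); rewrite ?andbF //=.
  rewrite (_ : all (r a) v); first by [].
  by apply/allP => x /(allP bv); apply: r_tr.
rewrite [X in X + _](zero _ _ _ b _ _ erefl); first last.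
- by move=> w /perm_shuffle/perm_mem->; rewrite mem_cat mem_head orbT.
- exact: negbTE.
have rba : r b a by rewrite r_tot // eq_sym.
rewrite add0r !pathE.
have Eu : \sum_(w <- shuffle (a :: u) v) (path r b w)%:R =
    (all (r b) (a :: u) && all (r b) v)%:R * \sum_(w <- shuffle (a :: u) v) (sorted r w)%:R :> A.
  rewrite mulr_sumr big_seq [RHS]big_seq; apply: eq_bigr => w /perm_shuffle/perm_all E.
  by rewrite pathE E all_cat -natrM mulnb.
rewrite Eu -IHv; last first.
  apply/allP => x /(allP duv); rewrite inE negb_or => /andP[] //.
rewrite -!natrM !mulnb /=; congr (_%:R); rewrite rba pathE /=.
case: (all (r b) v); rewrite /= ?andbF //= ?andbT.
case: (sorted r v); rewrite ?andbF //= ?andbT.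
have [au|] := boolP (all (r a) u); rewrite ?andbF //=.
rewrite (_ : all (r b) u); first by [].
by apply/allP => x /(allP au); apply: r_tr.
Qed.

End ShuffleCharacter.

(** * Ascents, descents and peaks *)

Section Links.

Variables (T U : Type) (f : T -> T -> U).
Implicit Types u v w : seq T.

Definition links w : seq U := if w is x :: w' then pairmap f x w' else [::].

Lemma links_cons x y w : links [:: x, y & w] = f x y :: links (y :: w).
Proof. by []. Qed.

Lemma links_take n w : links (take n w) = take n.-1 (links w).
Proof.
elim: w n => [|x w IH] [|n] //; first by rewrite !take0.
case: w IH => [|y w] IH //.
by case: n => //= n; have /= := IH n.+1 => ->.
Qed.

Lemma links_drop n w : links (drop n w) = drop n (links w).
Proof.
elim: n w => [|n IH] [|x w] //; first by rewrite !drop0.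
by rewrite drop_cons IH; case: w => //=.
Qed.

Lemma links_cat u x y v :
  links (rcons u x ++ y :: v) = links (rcons u x) ++ f x y :: links (y :: v).
Proof.
case: u => [|a u] //=.
by rewrite pairmap_cat last_rcons.
Qed.

End Links.

Lemma links_map (S T U : Type) (f : T -> T -> U) (g : S -> T) w :
  links f (map g w) = links (fun x y => f (g x) (g y)) w.
Proof. by case: w => //= x w; elim: w x => //= y w IH x; rewrite IH. Qed.

(** Entry [i] concerns the letter at position [i.+1], which has a neighbour on each side: an ascent
    leads to it and a descent leaves it. *)
Definition peaks (T : Type) (r : rel T) (w : seq T) : seq bool :=
  links (fun a b => a && ~~ b) (links r w).

Arguments peaks : simpl never.

Definition negr (T : Type) (r : rel T) : rel T := fun x y => ~~ r x y.

Section Alternating.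

Variables (L : Type) (r : rel L) (A : comNzRingType).
Implicit Types w : seq L.

(** For nonempty [w] the terms cancel in pairs: exactly one of the letters next to the cut can be
    moved across it, and the move changes the sign. *)
Lemma alternating_cuts w :
  \sum_(p <- cuts w) (-1) ^+ size p.1 * (sorted r p.1)%:R * (sorted (negr r) p.2)%:R
  = conv1 A w.
Proof.
case: w => [|x w]; first by rewrite big_seq1 /= !mulr1.
(* Up to sign, these are the cuts of [x :: w] with a nonempty left piece; they cancel the remaining
   cut. *)
have path_alt : \sum_(p <- cuts w) (-1) ^+ size p.1 * (path r x p.1)%:R *
    (sorted (negr r) p.2)%:R = (path (negr r) x w)%:R :> A.
  elim: w x => [|y w IH] x; first by rewrite big_seq1 /= !mulr1.
  rewrite sum_cuts_cons /= !mul1r; under eq_bigr => p _ do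
    rewrite exprS -mulnb natrM mulN1r !mulNr mulrCA -mulrA.
  rewrite sumrN -mulr_sumr.
  rewrite IH /negr; case: (r x y); rewrite ?mul1r ?mul0r ?subr0 //.
  by rewrite subrr.
rewrite sum_cuts_cons /= !mul1r; under eq_bigr => p _ do
  rewrite exprS mulN1r !mulNr.
by rewrite sumrN path_alt subrr.
Qed.

(* The value of [sum_cuts_hook]: the bottom of a peakless word can close the
   descending part or open the ascending one. *)
Definition hook_count w : int := if has id (peaks r w) then 0 else 2.

Lemma sum_cuts_hook w : ~~ nilp w ->
  \sum_(p <- cuts w) (sorted (negr r) p.1)%:R * (sorted r p.2)%:R =
  (hook_count w)%:~R :> A.
Proof.
case: w => // x w _; rewrite sum_cuts_cons /= mul1r /hook_count.
elim: w x => [|y w IH] x; first by rewrite big_seq1 /= mulr1.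
have peaksE z : peaks r [:: x, y, z & w] = (r x y && ~~ r y z) :: peaks r [:: y, z & w].
  by [].
rewrite sum_cuts_cons /= mul1r; under eq_bigr => p _ do
  rewrite -mulnb natrM -mulrA.
rewrite -mulr_sumr /negr.
have [rxy|rxy] := boolP (r x y).
  rewrite mul0r addr0 /=.
  (* After the ascent from [x] to [y], the first descent in [y :: w] makes a peak. *)
  have -> : has id (peaks r [:: x, y & w]) = ~~ path r y w.
    elim: w x y rxy {IH peaksE} => [|z w IH] x y rxy //.
    rewrite -[peaks _ _]/((r x y && ~~ r y z) :: peaks r [:: y, z & w]) /= rxy.
    by have [/IH->|] := boolP (r y z).
  by case: (path r y w); rewrite ?addr0.
rewrite add0r mul1r IH.
case: w {IH peaksE} => //= z w.
by rewrite (negPf rxy).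
Qed.

End Alternating.

(** * Monomials and the elementary factors of a chain *)

Definition X (m : monom) : series := fun m' => (m' == m)%:R.

Lemma series_sum (T : Type) (s : seq T) (F : T -> series) m :
  (\sum_(i <- s) F i) m = \sum_(i <- s) F i m.
Proof. by elim: s => [|i s IH]; rewrite ?big_nil // !big_cons -IH. Qed.

Lemma X_mul a b : X a * X b = X (mmul a b).
Proof.
apply/funext => m; rewrite [LHS](series_mulE _ _ (@divsP m)) /X.
have [ab|abm] := eqVneq m (mmul a b); last first.
  rewrite big1 // => x _; rewrite big1 // => y _.
  have [->|] := eqVneq x a; last by rewrite mul0r mulr0.
  have [->|] := eqVneq y b; last by rewrite !mulr0.
  by rewrite eq_sym (negPf abm) mul0r.
rewrite (big_fsetD1 a) /=; last by apply: (@mem_divs _ _ b).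
rewrite [X in _ + X]big1_seq ?addr0; last first.
  move=> x /=; rewrite in_fsetD1 => /andP[/negPf xa _].
  by rewrite big1 // => y _; rewrite xa mul0r mulr0.
rewrite (big_fsetD1 b) /=; last by apply: (@mem_divs _ _ a); rewrite mmulC.
rewrite big1_seq ?addr0; last first.
  move=> y /=; rewrite in_fsetD1 => /andP[/negPf yb _].
  by rewrite yb !mulr0.
by rewrite !eqxx ab eqxx !mulr1.
Qed.

Lemma mvar_mul v a b : mmul (mvar v a) (mvar v b) = mvar v (a + b).
Proof.
apply/fmapP => i; rewrite mmulE !fnd_set fnd_fmap0.
by case: eqP.
Qed.

Section ChainSeries.

Variables (L : eqType) (r : rel L) (ty : L -> bool).
Implicit Types (u v w : seq L) (c : int) (cs : seq int).

(** The empty word gives 1, whereas a nonempty word of letters of exponent 0 gives x_c^0, a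
    different monomial. *)
Definition wmon c w : monom := if nilp w then mone else mvar `|c|%N (count ty w).

Lemma wmon_cat c u v : wmon c (u ++ v) = mmul (wmon c u) (wmon c v).
Proof.
case: u v => [|a u] [|b v]; rewrite /wmon /= ?mmul1m //.
- by rewrite cats0 mmulC mmul1m.
- by rewrite count_cat addnA mvar_mul.
Qed.

Lemma wmon_perm c u v : perm_eq u v -> wmon c u = wmon c v.
Proof.
move=> uv; rewrite /wmon /nilp (perm_size uv).
by have /seq.permP-> := uv.
Qed.

(* The contribution of a run of consecutive elements with the value c. *)
Definition runs c w : series :=
  (sorted (if 0 < c then r else negr r) w)%:R * X (wmon c w).

(** If [cs] increases for [preceq], this is the generating series of the enriched partitions of the
    chain [w] with values in [cs]; see [Kvals_enriched] and [mem_enriched_words]. *)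
Definition Kvals cs : seq L -> series := conv_seq runs cs.

Lemma runs_nil c : runs c [::] = 1.
Proof. by rewrite /runs mul1r. Qed.

Lemma Kvals_nil cs : Kvals cs [::] = 1.
Proof. by elim: cs => //= c cs IH; rewrite conv_nil ?runs_nil. Qed.

End ChainSeries.

Section Product.

Variables (L : eqType) (r : rel L) (ty : L -> bool).
Hypotheses (r_tr : transitive r) (nr_tr : transitive (negr r)).
Hypothesis r_tot : forall x y, x != y -> r x y = ~~ r y x.

(** The monomial depends only on the letters of the word, so it is common to all shuffles;
    [shuffle_char_sorted] deals with the rest. *)
Lemma shuffle_char_runs c : shuffle_char (runs r ty c).
Proof.
have ch : shuffle_char (A := series) (fun w : seq L => (sorted (if 0 < c then r else negr r) w)%:R).
  case: ifP => _; apply: shuffle_char_sorted => // x y xy.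
  by rewrite /negr r_tot // eq_sym.
move=> u v duv; rewrite /runs mulrACA X_mul -wmon_cat ch // mulr_suml.
rewrite big_seq [RHS]big_seq; apply: eq_bigr => w /perm_shuffle wuv.
by rewrite (wmon_perm _ _ wuv).
Qed.

Lemma shuffle_char_Kvals cs : shuffle_char (Kvals r ty cs).
Proof.
elim: cs => [|c cs IH]; first exact: shuffle_char_conv1.
exact: shuffle_char_conv (shuffle_char_runs c) IH.
Qed.

End Product.

Section Antipode.

Variables (L : eqType) (r : rel L) (ty : L -> bool).

(** Chosen so that a word descends for [r] exactly when its reverse ascends for [dualr]. *)
Definition dualr : rel L := fun x y => ~~ r y x.

(** After reversal the two factors are sorted for complementary relations [q] and [negr q], and
    every cut gives the monomial of the whole word; [alternating_cuts] concludes. *)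
Lemma signed_rev_runs c :
  conv (signed_rev (runs dualr ty c)) (runs r ty c) =1 @conv1 L series.
Proof.
move=> w; pose q := if 0 < c then negr r else r.
have E1 u : signed_rev (runs dualr ty c) u = (-1) ^+ size u * (sorted q u)%:R * X (wmon ty c u).
  rewrite /signed_rev /runs rev_sorted (wmon_perm _ _ (permEl (perm_rev u))) mulrA.
  have -> : sorted (fun x y => (if 0 < c then dualr else negr dualr) y x) u = sorted q u; last by [].
  rewrite /q; case: ifP => _ //.
  by apply: eq_sorted => x y; rewrite /negr /dualr negbK.
have E2 u : runs r ty c u = (sorted (negr q) u)%:R * X (wmon ty c u).
  rewrite /runs.
  have -> : sorted (if 0 < c then r else negr r) u = sorted (negr q) u; last by [].
  rewrite /q; case: ifP => _ //.
  by apply: eq_sorted => x y; rewrite /negr negbK.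
rewrite /conv; under eq_bigr => p _ do rewrite E1 E2 mulrACA.
transitivity (conv1 series w * X (wmon ty c w)).
  rewrite -(alternating_cuts q) mulr_suml big_seq [RHS]big_seq.
  apply: eq_bigr => p /cuts_cat->.
  by rewrite X_mul wmon_cat.
by case: w => [|a w]; rewrite /conv1 ?mul0r ?mul1r.
Qed.

(** [signed_rev] reverses the order of the factors, so the two factors of the first value meet in
    the middle and cancel. *)
Lemma signed_rev_Kvals cs :
  conv (signed_rev (Kvals dualr ty cs)) (Kvals r ty cs) =1 @conv1 L series.
Proof.
elim: cs => [|c cs IH] w.
  rewrite /= conv1r /signed_rev /conv1; case: w => [|a w]; first by rewrite mul1r.
  by rewrite /nilp size_rev mulr0.
rewrite [conv _ _ _](eq_conv (@signed_rev_conv _ _ _ _) (frefl _)).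
rewrite -convA.
rewrite (eq_conv (frefl _) (convA _ _ _)).
rewrite (eq_conv (frefl _) (eq_conv (signed_rev_runs c) (frefl _))).
by rewrite (eq_conv (frefl _) (@conv1l _ _ _)) IH.
Qed.

End Antipode.

(** * Factorizations of a word and the expansion on the basis M *)

Section Segmentations.

Variable L : Type.
Implicit Types (u w : seq L) (s t : seq (seq L)).

(** The factorizations of [w] into nonempty consecutive pieces. *)
Fixpoint segm w : seq (seq (seq L)) :=
  if w is a :: w' then
    map (cons [:: a]) (segm w') ++
    flatten [seq if s is b :: t then [:: (a :: b) :: t] else [::] | s <- segm w']
  else [:: [::]].

Arguments segm : simpl never.

Lemma sum_segm_cons (V : nmodType) (F : seq (seq L) -> V) a w :
  \sum_(s <- segm (a :: w)) F s =
  \sum_(s <- segm w) F ([:: a] :: s) +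
  \sum_(s <- segm w) if s is b :: t then F ((a :: b) :: t) else 0.
Proof.
rewrite big_cat big_map big_flatten big_map /=; congr (_ + _).
by apply: eq_bigr => -[|b t] _; rewrite ?big_nil ?big_seq1.
Qed.

(** Both sides run over the factorizations of [w] with a marked place before, between or after the
    pieces. *)
Lemma sum_segm_cuts (V : nmodType) (G : seq (seq L) -> seq (seq L) -> V) w :
  \sum_(s <- segm w) \sum_(p <- cuts s) G p.1 p.2 =
  \sum_(p <- cuts w) \sum_(s <- segm p.1) \sum_(t <- segm p.2) G s t.
Proof.
elim: w G => [|a w IH] G; first by rewrite !big_seq1.
rewrite sum_segm_cons sum_cuts_cons [X in _ = X + _]big_seq1 sum_segm_cons.
under eq_bigr => s _ do rewrite sum_cuts_cons.
rewrite big_split /= (IH (fun s t => G ([:: a] :: s) t)).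
pose G' s t := if s is b :: s' then G ((a :: b) :: s') t else 0.
under [X in _ = _ + X]eq_bigr => p _ do rewrite sum_segm_cons.
rewrite big_split /=; rewrite addrACA; congr (_ + _).
have -> : \sum_(p <- cuts w) \sum_(s <- segm p.1)
     (if s is b :: t then \sum_(t0 <- segm p.2) G ((a :: b) :: t) t0 else 0) =
   \sum_(p <- cuts w) \sum_(s <- segm p.1) \sum_(t <- segm p.2) G' s t.
  apply: eq_bigr => p _; apply: eq_bigr => -[|b s] _ //=.
  by rewrite big1.
rewrite -IH -big_split /=; apply: eq_bigr => -[|b t] _.
  by rewrite big_seq1 addr0.
by rewrite !sum_cuts_cons /= add0r.
Qed.

Lemma sum_cuts_behead (V : nmodType) (F : seq L * seq L -> V) w :
  \sum_(p <- cuts w) F p =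
  F ([::], w) + \sum_(p <- cuts w) if nilp p.1 then 0 else F p.
Proof.
case: w => [|a w]; first by rewrite !big_seq1 /= addr0.
by rewrite !sum_cuts_cons /= add0r.
Qed.

Lemma sum_segm_head (V : nmodType) (F : seq L -> seq (seq L) -> V) w :
  \sum_(s <- segm w) (if s is b :: t then F b t else 0) =
  \sum_(p <- cuts w) if nilp p.1 then 0 else \sum_(t <- segm p.2) F p.1 t.
Proof.
elim: w F => [|a w IH] F; first by rewrite !big_seq1.
rewrite sum_segm_cons sum_cuts_cons /= add0r (IH (fun b t => F (a :: b) t)).
by rewrite [RHS]sum_cuts_behead.
Qed.

End Segmentations.

Arguments segm : simpl never.

(* [M al] in the variables of the list [vs] only. *)
Fixpoint Mvars (vs : seq nat) (al : wcomp) : series :=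
  if vs is v :: vs' then
    Mvars vs' al + (if al is a :: al' then X (mvar v a) * Mvars vs' al' else 0)
  else (nilp al)%:R.

Definition signed (vs : seq nat) : seq int :=
  flatten [seq [:: - v%:Z; v%:Z] | v <- vs].

Section ChainExpansion.

Variables (L : eqType) (r : rel L) (ty : L -> bool).
Implicit Types (w : seq L) (s : seq (seq L)).

Definition contents s : wcomp := map (fun b => (count ty b : nat)) s.

Definition segm_coef s : int := \prod_(b <- s) hook_count r b.

(** By [Kvals_Kser], the limit of [Kvals] over the values -1, 1, ..., -N, N; this form is an
    expansion on the basis M, where the coproduct is defined. *)
Definition Kser w : series := \sum_(s <- segm w) M (contents s) *~ segm_coef s.

(** The values [-v] and [v] give the same variable, so the monomial factors out and [sum_cuts_hook]
    counts the cuts into a descending run and an ascending one. *)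
Lemma conv_runs (v : nat) w : (0 < v)%N -> ~~ nilp w ->
  conv (runs r ty (- v%:Z)) (runs r ty v) w =
  X (mvar v (count ty w)) *~ hook_count r w.
Proof.
move=> v0 w0; rewrite -mulrzl -(@sum_cuts_hook _ r series w w0) mulr_suml big_seq [LHS]big_seq.
apply: eq_bigr => p /cuts_cat pw; rewrite /runs mulrACA X_mul.
have -> : wmon ty (- v%:Z) p.1 = wmon ty v p.1 by rewrite /wmon abszN.
rewrite -wmon_cat -pw /wmon (negPf w0) /=.
by rewrite oppr_gt0 !ltz_nat v0 ltn0.
Qed.

Lemma Kvals_signed_cons v vs w : (0 < v)%N ->
  Kvals r ty (signed (v :: vs)) w =
  Kvals r ty (signed vs) w + \sum_(p <- cuts w) if nilp p.1 then 0 else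
     X (mvar v (count ty p.1)) *~ hook_count r p.1 * Kvals r ty (signed vs) p.2.
Proof.
move=> v0; rewrite [LHS]convA /conv sum_cuts_behead /=.
rewrite big_seq1 /= !runs_nil mul1r mul1r; congr (_ + _).
apply: eq_bigr => p _; case: ifP => // /negbT p1.
by have := conv_runs v0 p1; rewrite /conv => ->.
Qed.

(** Both sides obey the same recursion on [vs]: the first variable takes either nothing or a
    nonempty prefix of [w], the first piece of a factorization. *)
Lemma Kvals_segm vs w : all (fun v => 0 < v)%N vs ->
  Kvals r ty (signed vs) w = \sum_(s <- segm w) Mvars vs (contents s) *~ segm_coef s.
Proof.
elim: vs w => [|v vs IH] w.
  case: w => [|a w] _; first by rewrite big_seq1 /segm_coef big_nil.
  rewrite sum_segm_cons big1 ?add0r; last by move=> s _; rewrite mul0rz.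
  by rewrite /Kvals /= /conv1 big1 // => -[|b s] _ //; rewrite mul0rz.
move=> /andP[v0 vs0]; rewrite Kvals_signed_cons // IH //.
under [RHS]eq_bigr => s _ do rewrite [Mvars _ _]/= mulrzDl.
rewrite big_split /=; congr (_ + _).
transitivity (\sum_(s <- segm w) if s is b :: t then
    X (mvar v (count ty b)) *~ hook_count r b * (Mvars vs (contents t) *~ segm_coef t)
    else 0 : series).
  rewrite (sum_segm_head (fun b t => X (mvar v (count ty b)) *~ hook_count r b * (Mvars vs (contents t) *~ segm_coef t))).
  apply: eq_bigr => p _; case: ifP => // _.
  by rewrite IH // mulr_sumr.
apply: eq_bigr => -[|b t] _ /=; first by rewrite mul0rz.
by rewrite /segm_coef big_cons mulrzA mulrzAl mulrzAr -!mulrzA [_ * hook_count _ _]mulrC.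
Qed.

End ChainExpansion.

(** * Truncation to finitely many variables *)

Definition supp_le (N : nat) (m : monom) := forall i, i \in domf m -> (i <= N)%N.

Definition agree (N : nat) (f g : series) := forall m, supp_le N m -> f m = g m.

Lemma agree_eq f g : (forall N, agree N f g) -> f = g.
Proof.
move=> fg; apply/funext => m; apply: (fg (\max_(i <- enum_fset (domf m)) i)%N) => i im.
by rewrite (big_rem i) //= leq_maxl.
Qed.

Lemma agree_refl N f : agree N f f. Proof. by []. Qed.

Lemma agree_sym N f g : agree N f g -> agree N g f.
Proof. by move=> fg m mN; rewrite fg. Qed.

Lemma agree_trans N f g h : agree N f g -> agree N g h -> agree N f h.
Proof. by move=> fg gh m mN; rewrite fg // gh. Qed.

Lemma agree_add N f f' g g' :
  agree N f f' -> agree N g g' -> agree N (f + g) (f' + g').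
Proof.
by move=> ff gg m mN; rewrite -[LHS]/(f m + g m) ff // gg.
Qed.

Lemma agree_opp N f f' : agree N f f' -> agree N (- f) (- f').
Proof. by move=> ff m mN; rewrite -[LHS]/(- f m) ff. Qed.

Lemma agree_sum N (T : Type) (s : seq T) (F G : T -> series) :
  (forall i, agree N (F i) (G i)) -> agree N (\sum_(i <- s) F i) (\sum_(i <- s) G i).
Proof.
move=> FG; elim: s => [|i s IH]; rewrite ?big_nil // !big_cons.
exact: agree_add.
Qed.

Lemma agree_mulz N f f' (k : int) : agree N f f' -> agree N (f *~ k) (f' *~ k).
Proof.
move=> ff; have nat_case (n : nat) : agree N (f *+ n) (f' *+ n).
  by elim: n => [|n IH] //; rewrite !mulrS; apply: agree_add.
case: k => n; first exact: nat_case.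
by rewrite NegzE !mulrNz; apply: agree_opp (nat_case _).
Qed.

(** The divisors of a monomial involve only its own variables. *)
Lemma agree_mul N f f' g g' :
  agree N f f' -> agree N g g' -> agree N (f * g) (f' * g').
Proof.
move=> ff gg m mN; rewrite [LHS](series_mulE _ _ (@divsP m)) [RHS](series_mulE _ _ (@divsP m)).
apply: eq_bigr => a _; apply: eq_bigr => b _.
have [abm|] := eqVneq; last by rewrite !mul0r.
have am i : i \in domf a -> i \in domf m.
  by move=> ia; rewrite -abm /mmul /= in_fsetU ia.
have bm i : i \in domf b -> i \in domf m.
  by move=> ib; rewrite -abm /mmul /= in_fsetU ib orbT.
by rewrite ff ?gg // => i => [/bm|/am] /mN.
Qed.

(** Only the fibre of [mu] over [m] has to lie in [e], so [A] may be infinite. *)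
Lemma formal_sumE (T : choiceType) (A : set T) (mu : T -> monom) (e : seq T) m :
    uniq e -> [set` e] `<=` A -> (forall t, A t -> mu t = m -> t \in e) ->
  formal_sum A mu m = (\sum_(t <- e) X (mu t)) m.
Proof.
move=> eu eA Ae; rewrite series_sum /formal_sum (fsbigE e) //; last first.
  by move=> t At te; case: eqP => // /esym/(Ae _ At); rewrite (negPf te).
rewrite big_seq_cond [RHS]big_seq_cond; apply: eq_bigl => t.
have [te|] := boolP (t \in e); last by [].
by rewrite /= mem_set //; apply: eA.
Qed.

Lemma dom_mvar_prod (T : eqType) (s : seq T) (f : T -> nat) (a : T -> nat) t :
  t \in s -> f t \in domf (\big[mmul/mone]_(i <- s) mvar (f i) (a i)).
Proof.
elim: s => // i s IH; rewrite inE big_cons /mmul /= in_fsetU => /orP[/eqP->|/IH->].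
  by rewrite in_fsetU in_fset1 eqxx.
by rewrite orbT.
Qed.

Lemma iota1_pos N : all (fun v => 0 < v)%N (iota 1 N).
Proof. by apply/allP => v; rewrite mem_iota => /andP[]. Qed.

(** * The monomial series in finitely many variables *)

(** The recursion of [Mvars], with index sequences in place of monomials. *)
Fixpoint subwords (vs : seq nat) (al : wcomp) : seq (seq nat) :=
  if vs is v :: vs' then
    subwords vs' al ++ (if al is _ :: al' then map (cons v) (subwords vs' al') else [::])
  else if al is [::] then [:: [::]] else [::].

Lemma mem_subwords vs al g : sorted ltn vs ->
  (g \in subwords vs al) = [&& size g == size al, all (mem vs) g & sorted ltn g].
Proof.
elim: vs al g => [|v vs IH] al g /=; first by move=> _; case: al => [|? ?]; case: g => [|? ?] //=; rewrite ?inE ?andbF.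
rewrite (path_sortedE ltn_trans) => /andP[/allP vvs vss].
rewrite mem_cat IH //.
have nvv : v \notin vs by apply/negP => /vvs; rewrite /= ltnn.
case: g => [|x g]; first by case: al => [|a al] //=; case: mapP => // -[].
case: al => [|a al]; first by [].
have -> : (x :: g \in map (cons v) (subwords vs al)) = (x == v) && (g \in subwords vs al).
  apply/mapP/andP => [[h hs [-> ->]]|[/eqP-> gs]]; first by rewrite eqxx.
  by exists g.
rewrite IH //= !inE eqSS (path_sortedE ltn_trans).
have [->|xv] /= := eqVneq x v.
  rewrite (negPf nvv) /= andbF /=; case: (size g == size al) => //=.
  case: (sorted ltn g); rewrite ?andbF ?andbT //.
  apply/allP/andP => [gvs|[/allP g1 /allP g2] y yg].
    by split; apply/allP => y /gvs yvs; [rewrite /= inE [y \in vs]yvs orbT | apply: vvs].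
  have := g1 _ yg; rewrite /= inE => /orP[/eqP yv|//].
  by have := g2 _ yg; rewrite /= yv ltnn.
rewrite orbF; case: (size g == size al) => //=.
have [xvs|] //= := boolP (x \in vs).
have [/allP xg|_] := boolP (all (ltn x) g); rewrite /= ?andbF //.
case: (sorted ltn g); rewrite ?andbF ?andbT //.
apply/allP/allP => gvs y yg; have := gvs _ yg; rewrite /= inE.
  by move->; rewrite orbT.
case/orP => // /eqP yv; have := ltn_trans (vvs _ xvs) (xg _ yg).
by rewrite yv ltnn.
Qed.

Lemma subwords_uniq vs al : sorted ltn vs -> uniq (subwords vs al).
Proof.
elim: vs al => [|v vs IH] al /=; first by case: al.
rewrite (path_sortedE ltn_trans) => /andP[/allP vvs vss].
rewrite cat_uniq IH //=; case: al => //= a al.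
rewrite map_inj_uniq ?IH ?andbT //; last by move=> ? ? [].
apply/hasPn => _ /mapP[g _ ->]; rewrite mem_subwords //=.
have [/vvs|] := boolP (v \in vs); last by rewrite andbF.
by rewrite /= ltnn.
Qed.

Lemma Mvars_subwords vs al :
  Mvars vs al = \sum_(g <- subwords vs al) X (\big[mmul/mone]_(p <- zip g al) mvar p.1 p.2).
Proof.
elim: vs al => [|v vs IH] [|a al] /=; rewrite ?big_seq1 ?big_nil //.
  by rewrite cats0 addr0 IH.
rewrite big_cat big_map /= !IH mulr_sumr; congr (_ + _).
by apply: eq_bigr => g _; rewrite big_cons -X_mul.
Qed.

(** A variable with exponent 0 still belongs to the domain of a monomial, so the indices that
    produce a monomial in x_1, ..., x_N are all at most [N]. *)
Lemma M_Mvars N al : agree N (M al) (Mvars (iota 1 N) al).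
Proof.
move=> m mN; rewrite Mvars_subwords.
have srt : sorted ltn (iota 1 N) by apply: iota_ltn_sorted.
pose toF (g : seq nat) := [ffun j : 'I_(size al) => nth 0%N g j].
have wE g : size g = size al ->
    wmonom (toF g) = \big[mmul/mone]_(p <- zip g al) mvar p.1 p.2.
  move=> sg; rewrite /wmonom (big_nth (0, 0)%N) size_zip sg minnn big_mkord.
  by apply: eq_bigr => j _; rewrite ffunE nth_zip.
rewrite [LHS](@formal_sumE _ _ _ (map toF (subwords (iota 1 N) al))); first 1 last.
- rewrite map_inj_in_uniq ?subwords_uniq // => g h.
  rewrite !mem_subwords // => /andP[/eqP sg _] /andP[/eqP sh _] /ffunP E.
  apply: (@eq_from_nth _ 0%N); rewrite ?sg ?sh // => i il.
  by have := E (Ordinal il); rewrite !ffunE.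
- move=> _ /mapP[g + ->]; rewrite mem_subwords // => /and3P[/eqP sg /allP gN gs] /=.
  split=> [j|j k jk]; rewrite !ffunE.
    have /gN : nth 0%N g j \in g by rewrite mem_nth ?sg.
    by rewrite /= mem_iota => /andP[].
  by apply: (sorted_ltn_nth ltn_trans) => //; rewrite inE sg.
- move=> i inc_i im; apply/mapP; exists (map i (enum 'I_(size al))); last first.
    apply/ffunP => j; rewrite ffunE (nth_map j) ?size_enum_ord //.
    by rewrite nth_ord_enum.
  rewrite mem_subwords // size_map size_enum_ord eqxx /=; apply/andP; split.
    apply/allP => _ /mapP[j _ ->] /=; rewrite mem_iota add1n ltnS (proj1 inc_i) /=.
    by apply: mN; rewrite -im; apply: dom_mvar_prod (mem_index_enum j).
  exact: increasing_sorted inc_i.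
rewrite big_map big_seq [in RHS]big_seq; congr (_ m); apply: eq_bigr => g.
by rewrite mem_subwords // => /andP[/eqP/wE->].
Qed.

(** * Enriched partitions of a chain *)

Lemma preceq_trans : transitive preceq.
Proof.
move=> b a c; rewrite /preceq => /orP[ab|/andP[/eqP ab ab']] /orP[bc|/andP[/eqP bc bc']].
- by rewrite (ltn_trans ab bc).
- by rewrite -bc ab.
- by rewrite ab bc.
- by rewrite ab bc ltnn eqxx (le_trans ab' bc').
Qed.

Lemma preceq_refl : reflexive preceq.
Proof. by move=> a; rewrite /preceq eqxx lexx orbT. Qed.

Lemma preceq_anti : antisymmetric preceq.
Proof.
move=> a b; rewrite /preceq; case: (ltngtP `|a|%N `|b|%N) => //= _.
exact: le_anti.
Qed.

Definition prec (a b : int) := preceq a b && (a != b).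

Lemma prec_trans : transitive prec.
Proof.
move=> b a c /andP[ab nab] /andP[bc nbc]; rewrite /prec (preceq_trans ab bc) /=.
by apply: contraNneq nab => ac; apply/eqP/preceq_anti; rewrite ab ac bc.
Qed.

Section EnrichedWords.

Variables (L : eqType) (r : rel L) (ty : L -> bool).
Implicit Types (w : seq L) (c : int) (cs g : seq int).

(** For [r] equal to [ltn], [negr r] is a weak inequality; as the labels of a chain are distinct, it
    amounts to the strict one in [enriched]. *)
Definition enriched_step : rel (int * L) := fun p q =>
  preceq p.1 q.1 && ((p.1 == q.1) ==> (if 0 < p.1 then r else negr r) p.2 q.2).

Fixpoint enriched_words cs w : seq (seq int) :=
  if cs is c :: cs' then
    [seq nseq (size p.1) c ++ g |
       p <- [seq p <- cuts w | sorted (if 0 < c then r else negr r) p.1],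
       g <- enriched_words cs' p.2]
  else if nilp w then [:: [::]] else [::].

Lemma Kvals_enriched cs w :
  Kvals r ty cs w =
  \sum_(g <- enriched_words cs w) X (\big[mmul/mone]_(p <- zip g w) mvar `|p.1|%N (ty p.2)).
Proof.
elim: cs w => [|c cs IH] w.
  case: w => [|a w] /=; last by rewrite big_nil.
  by rewrite big_seq1 big_nil.
rewrite big_allpairs_dep big_filter big_mkcond /=.
rewrite [LHS]big_seq [RHS]big_seq; apply: eq_bigr => p /cuts_cat pw.
rewrite IH /runs; case: (sorted _ p.1); last by rewrite mulr0n !mul0r.
rewrite mulr1n mul1r mulr_sumr; apply: eq_bigr => g _.
rewrite X_mul pw zip_cat ?size_nseq // big_cat /=; congr (X (mmul _ _)).
rewrite /wmon; elim: p.1 => [|a u]; first by rewrite big_nil.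
rewrite /= big_cons /=; case: u => [|b u] /= IHu; first by rewrite big_nil mmulC mmul1m addn0.
by rewrite -IHu mvar_mul.
Qed.

Lemma path_enriched_nseq c a u s :
  path enriched_step (c, a) (zip (nseq (size u) c) u ++ s) =
  path (if 0 < c then r else negr r) a u && path enriched_step (c, last a u) s.
Proof.
elim: u a => [|b u IH] a //=.
by rewrite IH /enriched_step /= preceq_refl eqxx andbA.
Qed.

Lemma mem_enriched_words cs w g : sorted prec cs ->
  (g \in enriched_words cs w) =
  [&& size g == size w, all (mem cs) g & sorted enriched_step (zip g w)].
Proof.
elim: cs w g => [|c cs IH] w g.
  by move=> _; case: w => [|? ?]; case: g => [|? ?] //=; rewrite ?inE ?andbF.
rewrite [sorted _ _]/= (path_sortedE prec_trans) => /andP[/allP ccs scs].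
have ncc : c \notin cs by apply/negP => /ccs; rewrite /prec eqxx andbF.
apply/allpairsPdep/and3P => [[[u v] [h [+ + ->]]]|[sg gcs gw]].
  rewrite mem_filter mem_cuts /= => /andP[su /eqP->]; rewrite IH //.
  case/and3P=> /eqP sh /allP hcs hv.
  split; first by rewrite !size_cat size_nseq sh.
    rewrite all_cat; apply/andP; split; first by rewrite all_nseq /= inE eqxx orbT.
    by apply/allP => x /hcs xcs; rewrite /= inE [x \in cs]xcs orbT.
  rewrite zip_cat ?size_nseq //; case: u su => [|a u] //= su.
  rewrite path_enriched_nseq su /=; case: h v sh hcs hv => [|b h] [|y v] //= _ hcs hv.
  rewrite hv andbT /enriched_step /=.
  by have /ccs/andP[-> /negPf->] : b \in cs by apply: hcs; rewrite mem_head.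
(* The first run, possibly empty, gathers all the entries equal to [c]. *)
suff [u [v [h [-> -> su hcs sh]]]] : exists u v h,
    [/\ w = u ++ v, g = nseq (size u) c ++ h,
        sorted (if 0 < c then r else negr r) u, all (mem cs) h &
        size h == size v /\ sorted enriched_step (zip h v)].
  exists (u, v), h; rewrite mem_filter mem_cuts eqxx andbT IH //.
  by case: sh => -> ->; rewrite hcs; split.
elim: g w sg gcs gw => [|b g IHg] [|x w] //=.
  by exists [::], [::], [::].
rewrite eqSS => sg /andP[bcs gcs] gw.
have [bc|bc] := eqVneq b c.
  have [u [v [h [wE gE su hcs [sh sw]]]]] := IHg _ sg gcs (path_sorted gw).
  exists (x :: u), v, h; rewrite wE gE bc; split=> //.
  case: u wE gE su => [|y u] wE gE //= ->; rewrite andbT.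
  by move: gw; rewrite wE gE bc /= => /andP[/andP[_]]; rewrite eqxx.
have {}bcs : b \in cs by move: bcs; rewrite inE (negPf bc).
exists [::], (x :: w), (b :: g); split=> //=.
rewrite [_ \in _]bcs; apply/allP => y yg.
have := allP gcs _ yg; rewrite /= inE => /orP[/eqP yc|//].
(* If [c] occurred after [b], then [b] would precede [c], which is the least value. *)
have : path preceq b g.
  elim: g w b x sg gw {IHg gcs bc bcs yg} => [|d g IHd] [|z w] b x //=.
  by rewrite eqSS => sg /andP[/andP[-> _] /(IHd _ _ _ sg)].
rewrite (path_sortedE preceq_trans) => /andP[/allP/(_ _ yg)].
rewrite yc => bc' _; have /andP[cb _] := ccs _ bcs.
by case/eqP: bc; apply: preceq_anti; rewrite bc' cb.
Qed.

Lemma enriched_words_uniq cs w : sorted prec cs -> uniq (enriched_words cs w).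
Proof.
elim: cs w => [|c cs IH] w; first by case: w.
rewrite [sorted _ _]/= (path_sortedE prec_trans) => /andP[/allP ccs scs].
have ncc : c \notin cs by apply/negP => /ccs; rewrite /prec eqxx andbF.
have nch h v : h \in enriched_words cs v -> count_mem c h = 0%N.
  rewrite mem_enriched_words // => /and3P[_ /allP hcs _].
  by apply/count_memPn/negP => /hcs; rewrite /= (negPf ncc).
apply: allpairs_uniq_dep => [|p _|]; first 1 last.
- exact: IH.
- move=> _ _ /allpairsPdep[[u v] [h [+ hv ->]]] /allpairsPdep[[u' v'] [h' [+ hv' ->]]] /=.
  rewrite !mem_filter !mem_cuts => /andP[_ /eqP wE] /andP[_ /eqP wE'] E.
  (* The length of the first run is the number of occurrences of [c]. *)
  have su : size u = size u'.
    have := congr1 (count_mem c) E; rewrite !count_cat !count_nseq /= eqxx !mul1n.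
    by rewrite (nch _ _ hv) (nch _ _ hv') !addn0.
  move: wE; rewrite wE' => /eqP; rewrite eqseq_cat // => /andP[/eqP uE /eqP vE].
  move: E hv hv'; rewrite uE vE => /eqP; rewrite eqseq_cat // => /andP[_ /eqP->].
  by [].
rewrite filter_uniq // cuts_iota map_inj_in_uniq ?iota_uniq // => i j.
rewrite !mem_iota !add0n !ltnS => iw jw [/(congr1 size)].
by rewrite !size_takel.
Qed.

End EnrichedWords.

Lemma mem_signed vs c : (c \in signed vs) = (`|c|%N \in vs).
Proof.
elim: vs => [|v vs IH] //; rewrite /signed /= !inE -/(signed vs) IH orbA; congr (_ || _).
by apply/orP/eqP => [[] /eqP|]; lia.
Qed.

Lemma path_signed_iota a k n : (`|a| < k)%N -> path prec a (signed (iota k n)).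
Proof.
elim: n a k => [|n IH] a k ak //.
rewrite -[signed _]/[:: - k%:Z, k%:Z & signed (iota k.+1 n)] /=.
rewrite IH ?absz_nat // /prec /preceq abszN absz_nat ak eqxx ltnn /= andbT.
by apply/andP; split; first (apply/eqP => aE; move: ak; rewrite aE abszN absz_nat ltnn);
  lia.
Qed.

Lemma sorted_signed_iota N : sorted prec (signed (iota 1 N)).
Proof. exact: path_sorted (@path_signed_iota 0 1 N isT). Qed.

(** [enriched] constrains all pairs of the chain, [sorted] only the consecutive ones; transitivity
    bridges the two. *)
Lemma enriched_step_ltn_trans : transitive (enriched_step ltn).
Proof.
move=> [b y] [a x] [c z] /andP[/= ab rab] /andP[/= bc rbc].
rewrite /enriched_step /= (preceq_trans ab bc) /=; apply/implyP => /eqP ac.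
have abE : a = b by apply: preceq_anti; rewrite ab ac bc.
move: rab rbc; rewrite -abE -ac eqxx /negr; case: ifP => _ /=; first exact: ltn_trans.
by rewrite -!leqNgt => yx zy; apply: leq_trans yx.
Qed.

Lemma zip_mapl (S T : Type) (f : S -> T) (s : seq S) :
  zip (map f s) s = [seq (f x, x) | x <- s].
Proof. by elim: s => //= x s ->. Qed.

Section ChainLambda.

Variables (s : seq nat) (S : {fset nat}).
Hypothesis s_uniq : uniq s.

Let P : {fset nat} := [fset x in s]%fset.
Let ltP : rel nat := fun x y => (index x s < index y s)%N.
(** [ext] and [toF] translate between functions on [P] and sequences of values along [s]; the
    default 0 is never reached on [s]. *)
Let ext (f : {ffun P -> int}) (x : nat) : int := if insub x is Some v then f v else 0.
Let toF (g : seq int) : {ffun P -> int} := [ffun v : P => nth 0 g (index (val v) s)].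

Let mem_P x : (x \in P) = (x \in s). Proof. by rewrite inE. Qed.

Let ext_val f (v : P) : ext f (val v) = f v.
Proof. by rewrite /ext valK. Qed.

Let toF_ext f : toF (map (ext f) s) = f.
Proof.
apply/ffunP => v; rewrite ffunE.
have vs : val v \in s by rewrite -mem_P; apply: valP.
by rewrite (nth_map 0%N) ?index_mem // nth_index // ext_val.
Qed.

Let ext_toF g : size g = size s -> map (ext (toF g)) s = g.
Proof.
move=> gs; apply: (@eq_from_nth _ 0); rewrite ?size_map // => i il.
rewrite (nth_map 0%N) // /ext; case: insubP => [v _ vE|].
  by rewrite ffunE vE index_uniq.
by rewrite mem_P mem_nth.
Qed.

Let monom_ext (f : {ffun P -> int}) : \big[mmul/mone]_(v : P) mvar `|f v|%N (val v \in S) =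
  \big[mmul/mone]_(p <- zip (map (ext f) s) s) mvar `|p.1|%N (p.2 \in S).
Proof.
transitivity (\big[mmul/mone]_(v : P) mvar `|ext f (val v)|%N (val v \in S)).
  by apply: eq_bigr => v _; rewrite ext_val.
rewrite -(@big_seq_fsetE _ _ mmul _ P xpredT (fun x => mvar `|ext f x|%N (x \in S))).
rewrite (perm_big s) /=; last first.
  by apply: uniq_perm; rewrite ?fset_uniq // => x; rewrite mem_P.
by rewrite zip_mapl big_map.
Qed.

Let enriched_ext (f : {ffun P -> int}) :
  enriched ltP f <-> all (fun a => a != 0) (map (ext f) s) /\
                     sorted (enriched_step ltn) (zip (map (ext f) s) s).
Proof.
rewrite zip_mapl; split=> [[f0 fP]|[/allP f0 fP]].
  split.
    apply/allP => _ /mapP[x xs ->]; rewrite -mem_P in xs.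
    by rewrite -[x]/(val [` xs]%fset) ext_val.
  rewrite sorted_map; apply/(sortedP 0%N) => i il.
  have is0 : nth 0%N s i \in P by rewrite mem_P mem_nth // ltnW.
  have is1 : nth 0%N s i.+1 \in P by rewrite mem_P mem_nth.
  have [] := fP [` is0]%fset [` is1]%fset.
    by rewrite /ltP /= !index_uniq // ltnW.
  rewrite /enriched_step /= -[nth _ _ i]/(val [` is0]%fset).
  rewrite -[nth _ _ i.+1]/(val [` is1]%fset) !ext_val => -> pos neg /=.
  apply/implyP => /eqP E; case: ifP => f1; first exact: pos.
  rewrite /negr -leqNgt ltnW // neg //.
  by rewrite lt_neqAle f0 leNgt f1.
split=> [v|x y xy].
  rewrite -ext_val; apply: f0; apply: map_f.
  by rewrite -mem_P; apply: valP.
have xs : val x \in s by rewrite -mem_P; apply: valP.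
have ys : val y \in s by rewrite -mem_P; apply: valP.
have := sorted_ltn_nth enriched_step_ltn_trans (0, 0%N) fP; rewrite sorted_map in fP *.
move=> /(_ (index (val x) s) (index (val y) s)).
rewrite !inE size_map !index_mem => /(_ xs ys xy).
rewrite !(nth_map 0%N) ?index_mem // !nth_index // !ext_val /enriched_step /=.
case/andP=> -> st; split=> // E fx; move: st; rewrite E eqxx /= -E.
  by rewrite fx.
(* Equal labels would have the same position, so the weak descent is strict. *)
rewrite ltNge (ltW fx) /= /negr -leqNgt leq_eqVlt => /orP[/eqP yx|//].
by have := xy; rewrite /ltP /= yx ltnn.
Qed.

Lemma Lambda_Kvals N :
  agree N (Lambda P ltP S) (Kvals ltn (fun x => x \in S) (signed (iota 1 N)) s).
Proof.
move=> m mN; rewrite Kvals_enriched.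
have srt := sorted_signed_iota N.
have memE g : g \in enriched_words ltn (signed (iota 1 N)) s ->
    [/\ size g = size s, all (fun a => a != 0) g & sorted (enriched_step ltn) (zip g s)].
  rewrite mem_enriched_words // => /and3P[/eqP gs /allP gN gst]; split=> //.
  apply/allP => a /gN /=; rewrite mem_signed mem_iota => /andP[].
  by rewrite absz_gt0.
rewrite [LHS](@formal_sumE _ _ _ (map toF (enriched_words ltn (signed (iota 1 N)) s))); first 1 last.
- rewrite map_inj_in_uniq ?enriched_words_uniq // => g h /memE[gs _ _] /memE[hs _ _] E.
  by rewrite -(ext_toF gs) -(ext_toF hs) E.
- move=> _ /mapP[g /memE[gs g0 gst] ->] /=.
  by apply/enriched_ext; rewrite ext_toF.
- move=> f /enriched_ext[f0 fst] fm; apply/mapP; exists (map (ext f) s); last by rewrite toF_ext.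
  rewrite mem_enriched_words // size_map eqxx fst andbT /=.
  apply/allP => a as_; rewrite /= mem_signed mem_iota add1n ltnS absz_gt0 (allP f0 _ as_) /=.
  apply: mN; rewrite -fm; case/mapP: as_ => x xs ->.
  rewrite -mem_P in xs; rewrite -[x]/(val [` xs]%fset) ext_val.
  by apply: dom_mvar_prod (mem_index_enum _).
rewrite big_map big_seq [in RHS]big_seq; congr (_ m); apply: eq_bigr => g /memE[gs _ _].
by rewrite monom_ext ext_toF.
Qed.

End ChainLambda.

Lemma Kvals_Kser (L : eqType) (r : rel L) (ty : L -> bool) w N :
  agree N (Kvals r ty (signed (iota 1 N)) w) (Kser r ty w).
Proof.
rewrite Kvals_segm; last exact: iota1_pos.
apply: agree_sum => t; apply: agree_mulz.
by apply: agree_sym; apply: M_Mvars.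
Qed.

Lemma Kser_eq (L L' : eqType) (r : rel L) (r' : rel L') ty ty' w w' :
  (forall vs, all (fun v => 0 < v)%N vs ->
     Kvals r ty (signed vs) w = Kvals r' ty' (signed vs) w') ->
  Kser r ty w = Kser r' ty' w'.
Proof.
move=> E; apply: agree_eq => N; refine (agree_trans _ (Kvals_Kser r' ty' w' (N := N))).
by rewrite -E ?iota1_pos //; exact: agree_sym (Kvals_Kser _ _ _ (N := N)).
Qed.

Lemma Lambda_Kser (s : seq nat) (S : {fset nat}) : uniq s ->
  Lambda [fset x in s]%fset (fun x y => (index x s < index y s)%N) S =
  Kser ltn (fun x => x \in S) s.
Proof.
move=> su; apply: agree_eq => N.
exact: agree_trans (Lambda_Kvals S su (N := N)) (Kvals_Kser _ _ _ (N := N)).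
Qed.

(** * Dependence on the peaks *)

Lemma count_types (L : Type) (ty : L -> bool) w : count ty w = count id (map ty w).
Proof. by rewrite count_map. Qed.

Lemma peaks_take (L : Type) (r : rel L) n w : peaks r (take n w) = take n.-2 (peaks r w).
Proof. by rewrite /peaks !links_take. Qed.

Lemma peaks_drop (L : Type) (r : rel L) n w : peaks r (drop n w) = drop n (peaks r w).
Proof. by rewrite /peaks !links_drop. Qed.

Section PeakInvariance.

Variables (L L' : eqType) (r : rel L) (r' : rel L') (ty : L -> bool) (ty' : L' -> bool).

(** In [Kvals_signed_cons] a prefix enters through its exponents and [hook_count], a suffix through
    the series in fewer variables, and the peaks of either are a segment of the peaks of [w]. *)
Lemma Kvals_peaks vs w w' : all (fun v => 0 < v)%N vs ->
    map ty w = map ty' w' -> peaks r w = peaks r' w' ->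
  Kvals r ty (signed vs) w = Kvals r' ty' (signed vs) w'.
Proof.
elim: vs w w' => [|v vs IH] w w'.
  by move=> _ /(congr1 size); rewrite !size_map /Kvals /= /conv1 /nilp => ->.
move=> /andP[v0 vs0] Ety Epk; have sz : size w = size w'.
  by have := congr1 size Ety; rewrite !size_map.
rewrite !Kvals_signed_cons // (IH _ w') //; congr (_ + _).
rewrite !cuts_iota !big_map sz; apply: eq_bigr => i _ /=.
have En : nilp (take i w) = nilp (take i w') by rewrite /nilp !size_take sz.
have Ec : count ty (take i w) = count ty' (take i w').
  by rewrite count_types map_take Ety -map_take -count_types.
have Eh : hook_count r (take i w) = hook_count r' (take i w').
  by rewrite /hook_count !peaks_take Epk.
have Ek : Kvals r ty (signed vs) (drop i w) = Kvals r' ty' (signed vs) (drop i w').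
  by apply: IH => //; rewrite ?map_drop ?Ety // !peaks_drop Epk.
by rewrite En Ec Eh Ek.
Qed.

Lemma Kser_peaks w w' :
  map ty w = map ty' w' -> peaks r w = peaks r' w' -> Kser r ty w = Kser r' ty' w'.
Proof. by move=> Ety Epk; apply: Kser_eq => vs vs0; apply: Kvals_peaks. Qed.

Lemma Kser_links w w' :
  map ty w = map ty' w' -> links r w = links r' w' -> Kser r ty w = Kser r' ty' w'.
Proof. by move=> Ety Elk; apply: Kser_peaks => //; rewrite /peaks Elk. Qed.

End PeakInvariance.

(* A letter is [(p, d)], where [p] tells whether the exponent is 1, and [d]
   whether the letter is a descent after a letter with the same exponent; in the
   chains, exponents 0, 1 form an ascent, and 1, 0 a descent. *)
Definition letter : Type := (bool * bool)%type.

Definition asc (x y : letter) : bool := if x.1 == y.1 then ~~ y.2 else y.1.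

Definition ltype (x : letter) : bool := x.1.

Definition Kword (w : seq letter) : series := Kser asc ltype w.

(** * Removal of descents between letters of exponent 0 *)

Section ZeroDescents.

Let has_peak (l : seq bool) := has id (links (fun a b => a && ~~ b) l).

Let has_peak_cons2 a b l : has_peak [:: a, b & l] = (a && ~~ b) || has_peak (b :: l).
Proof. by []. Qed.

(** The inserted ascents are followed by an ascent or by nothing, so they complete no peak; a peak
    ending at the head of [l'] is excluded likewise. *)
Let has_peak_ins l l' : head true l' -> has_peak (l ++ [:: true, true & l']) = has_peak (l ++ l').
Proof.
elim: l => [|a l IH] hl'.
  by rewrite !cat0s has_peak_cons2; case: l' hl' => [|[] l'].
case: l IH => [|b l] IH; last by rewrite !cat_cons !has_peak_cons2 IH.
by case: a; case: l' hl' {IH} => [|[] l'].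
Qed.

Let has_peak_mid l l' : has_peak (l ++ [:: true, false & l']).
Proof.
elim: l => // a l; case: l => [|b l] IH; first by rewrite /= has_peak_cons2 orbT.
by rewrite !cat_cons has_peak_cons2 -!cat_cons IH orbT.
Qed.

Let zA : letter := (false, false).
Let zD : letter := (false, true).

Let no_zD (V : seq letter) := zD \notin V.

Let asc_head x y V : ltype x = false -> no_zD (y :: V) -> asc x y.
Proof.
by case: x y => [? ?] [[] []] //= ->; rewrite /no_zD inE.
Qed.

Let links_after x V : ltype x = false -> no_zD V -> head true (links asc (x :: V)).
Proof. by case: V => // y V tx nV; apply: asc_head tx nV. Qed.

Let links_mid U z V : links asc (U ++ z :: V) = links asc (rcons U z) ++ links asc (z :: V).
Proof.
case: V => [|y V]; first by rewrite cats1 cats0.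
by rewrite -cat_rcons links_cat.
Qed.

(** The link after [x] is preceded by a descent or nothing and followed by an ascent or nothing, so
    it belongs to no peak, whatever its direction. *)
Lemma Kword_zD_first U x V : no_zD V ->
    (forall y U', U = rcons U' y -> asc y x = false) -> ltype x = false ->
  Kword (U ++ [:: x, zD & V]) = Kword (U ++ [:: x, zA & V]).
Proof.
move=> nV Ux tx; apply: Kser_peaks; first by rewrite !map_cat.
rewrite /peaks !links_mid !links_cons.
have -> : asc x zD = false by rewrite /asc [x.1]tx.
have -> : asc x zA = true by rewrite /asc [x.1]tx.
have -> : links asc (zD :: V) = links asc (zA :: V) by case: V {nV}.
have := links_after (x := zA) erefl nV; set l := links asc (zA :: V) => hl.
case/lastP: U Ux => [|U y] Ux; first by case: l hl => [|[] l].
rewrite -cats1 -cats1 -catA /= -[[:: y; x]]/([:: y] ++ [:: x]).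
rewrite links_mid /= (Ux y U) //.
rewrite -!catA /=; set k := links asc (rcons U y); elim: k => [|a k IH]; first by case: l hl => [|[] l].
case: k IH => [|b k] IH; rewrite /= in IH *; first by case: l hl IH => [|[] l].
by rewrite IH.
Qed.

Let hook_zAzD U x V : ltype x = false -> hook_count asc (U ++ [:: x, zA, zD & V]) = 0.
Proof.
move=> tx; rewrite /hook_count /peaks -/(has_peak _) links_mid !links_cons.
have -> : asc x zA = true by rewrite /asc [x.1]tx.
by rewrite has_peak_mid.
Qed.

Let hook_zAzA U x V : ltype x = false -> no_zD V ->
  hook_count asc (U ++ [:: x, zA, zA & V]) = hook_count asc (U ++ x :: V).
Proof.
move=> tx nV; rewrite /hook_count /peaks -!/(has_peak _) !links_mid !links_cons.
have -> : asc x zA = true by rewrite /asc [x.1]tx.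
rewrite has_peak_ins; last exact: links_after.
congr (if has_peak (_ ++ _) then _ else _).
by case: V nV => // y V nV; rewrite !links_cons !(asc_head _ nV).
Qed.

(** Compare the first pieces of the three words. Cuts inside [U] are settled by induction on [vs];
    the two cuts that separate the three zeros give equal terms. Past the zeros, the prefix with
    [zD] has a peak and contributes nothing, while [x, zA, zA] contributes as much as [x] alone. *)
Let Kvals_zD_second vs U x V : all (fun v => 0 < v)%N vs -> no_zD V -> ltype x = false ->
  Kvals asc ltype (signed vs) (U ++ [:: x, zA, zD & V]) +
  Kvals asc ltype (signed vs) (U ++ x :: V) =
  Kvals asc ltype (signed vs) (U ++ [:: x, zA, zA & V]).
Proof.
move=> vs0 nV tx; elim: vs vs0 U => [|v vs IH] vs0 U.
  by case: U => [|? ?]; rewrite /Kvals /= /conv1 /= addr0.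
case/andP: vs0 => v0 vs0.
rewrite !Kvals_signed_cons // addrACA IH //; congr (_ + _).
pose f (p : seq letter * seq letter) : series := if nilp p.1 then 0 else
  X (mvar v (count ltype p.1)) *~ hook_count asc p.1 * Kvals asc ltype (signed vs) p.2.
suff: \sum_(p <- cuts (U ++ [:: x, zA, zD & V])) f p +
  \sum_(p <- cuts (U ++ x :: V)) f p = \sum_(p <- cuts (U ++ [:: x, zA, zA & V])) f p by [].
have fE p q : f (p, q) = if nilp p then 0 else
  X (mvar v (count ltype p)) *~ hook_count asc p * Kvals asc ltype (signed vs) q by [].
clearbody f.
have splitU T : \sum_(p <- cuts (U ++ T)) f p + f (U, T) =
   \sum_(p <- cuts U) f (p.1, p.2 ++ T) + \sum_(p <- cuts T) f (U ++ p.1, p.2).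
  exact: sum_cuts_cat.
have split3 y z : \sum_(p <- cuts (U ++ [:: x, y, z & V])) f p =
   \sum_(p <- cuts U) f (p.1, p.2 ++ [:: x, y, z & V]) + f (U ++ [:: x], [:: y, z & V]) +
   f (U ++ [:: x; y], z :: V) + \sum_(p <- cuts V) f (U ++ [:: x, y, z & p.1], p.2).
  apply: (addIr (f (U, [:: x, y, z & V]))); rewrite splitU !sum_cuts_cons /= cats0.
  by rewrite [f (U, _) + _]addrC !addrA.
have split1 : \sum_(p <- cuts (U ++ x :: V)) f p =
   \sum_(p <- cuts U) f (p.1, p.2 ++ x :: V) + \sum_(p <- cuts V) f (U ++ x :: p.1, p.2).
  apply: (addIr (f (U, x :: V))); rewrite splitU !sum_cuts_cons /= cats0.
  by rewrite [f (U, _) + _]addrC !addrA.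
rewrite !split3 split1.
have nnil (T : seq letter) y : nilp (U ++ y :: T) = false by case: (U).
have -> : f (U ++ [:: x], [:: zA, zD & V]) = f (U ++ [:: x], [:: zA, zA & V]).
  rewrite !fE (@Kvals_peaks _ _ asc asc ltype ltype vs [:: zA, zD & V] [:: zA, zA & V]) //.
  rewrite /peaks !links_cons; have -> : links asc (zD :: V) = links asc (zA :: V) by case: (V).
  by have := links_after (x := zA) erefl nV; case: (links asc (zA :: V)) => [|[] l].
have -> : f (U ++ [:: x; zA], zD :: V) = f (U ++ [:: x; zA], zA :: V).
  rewrite !fE (@Kvals_peaks _ _ asc asc ltype ltype vs (zD :: V) (zA :: V)) //.
  by rewrite /peaks; congr links; case: (V).
have -> : \sum_(p <- cuts V) f (U ++ [:: x, zA, zD & p.1], p.2) = 0.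
  by apply: big1 => p _; rewrite !fE nnil (hook_zAzD U p.1 tx) mulr0z mul0r.
have -> : \sum_(p <- cuts V) f (U ++ [:: x, zA, zA & p.1], p.2) =
    \sum_(p <- cuts V) f (U ++ x :: p.1, p.2).
  rewrite big_seq [RHS]big_seq; apply: eq_bigr => p /cuts_cat pV.
  have nV1 : no_zD p.1 by move: nV; rewrite /no_zD pV mem_cat negb_or => /andP[].
  by rewrite !fE !nnil (hook_zAzA U tx nV1) !count_cat.
have -> : \sum_(p <- cuts U) f (p.1, p.2 ++ [:: x, zA, zA & V]) =
   \sum_(p <- cuts U) f (p.1, p.2 ++ [:: x, zA, zD & V]) +
   \sum_(p <- cuts U) f (p.1, p.2 ++ x :: V).
  rewrite -big_split /=; apply: eq_bigr => p _; rewrite !fE.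
  by case: ifP => _; [rewrite addr0 | rewrite -(IH vs0) mulrDr].
rewrite addr0 addrA; congr (_ + _).
by rewrite addrAC; congr (_ + _); rewrite addrAC.
Qed.

(* The two words with 3 letters of exponent 0 differ only in that the first forbids
   these letters to share a variable; if they do, they contribute x_k^0 to the
   monomial, as a single letter does. *)
Lemma Kword_zD_second U x V : no_zD V -> ltype x = false ->
  Kword (U ++ [:: x, zA, zD & V]) =
  Kword (U ++ [:: x, zA, zA & V]) - Kword (U ++ x :: V).
Proof.
move=> nV tx; apply/eqP; rewrite eq_sym subr_eq eq_sym; apply/eqP.
apply: agree_eq => N; have pos := iota1_pos N.
refine (agree_trans _ (Kvals_Kser _ _ _ (N := N))).
rewrite -Kvals_zD_second //.
by apply: agree_add; apply: agree_sym; apply: Kvals_Kser.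
Qed.

End ZeroDescents.

(** * Spans and linear extensions *)

Section Span.

Variables (V : zmodType) (A : set V).

Lemma zspanP x : zspan A x <->
  exists2 s : seq (V * int), (forall p, p \in s -> A p.1) & x = \sum_(p <- s) p.1 *~ p.2.
Proof.
split=> [[n [c [v [Av ->]]]]|[s sA ->]].
  exists [seq (v i, c i) | i <- enum 'I_n]; first by move=> _ /mapP[i _ ->]; apply: Av.
  by rewrite big_map big_enum.
exists (size s), (fun i => (tnth (in_tuple s) i).2), (fun i => (tnth (in_tuple s) i).1).
split=> [i|]; first by apply: sA; rewrite -[s]/(tval (in_tuple s)) mem_tnth.
by rewrite big_tnth.
Qed.

Lemma zspan_gen x : A x -> zspan A x.
Proof.
move=> Ax; apply/zspanP; exists [:: (x, 1)]; last by rewrite big_seq1 mulr1z.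
by move=> p; rewrite inE => /eqP->.
Qed.

Lemma zspan0 : zspan A 0.
Proof. by apply/zspanP; exists [::]; rewrite ?big_nil. Qed.

Lemma zspanD x y : zspan A x -> zspan A y -> zspan A (x + y).
Proof.
move=> /zspanP[s sA ->] /zspanP[t tA ->]; apply/zspanP; exists (s ++ t).
  by move=> p; rewrite mem_cat => /orP[/sA|/tA].
by rewrite big_cat.
Qed.

Lemma zspan_mulz x k : zspan A x -> zspan A (x *~ k).
Proof.
move=> /zspanP[s sA ->]; apply/zspanP; exists [seq (p.1, p.2 * k) | p <- s].
  by move=> _ /mapP[p ps ->]; apply: (sA p ps).
by rewrite big_map mulrz_suml; apply: eq_bigr => p _; rewrite mulrzA.
Qed.

Lemma zspanB x y : zspan A x -> zspan A y -> zspan A (x - y).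
Proof. by move=> Ax Ay; apply: zspanD => //; rewrite -mulrN1z; apply: zspan_mulz. Qed.

Lemma zspan_sum (T : eqType) (s : seq T) (F : T -> V) :
  (forall i, i \in s -> zspan A (F i)) -> zspan A (\sum_(i <- s) F i).
Proof.
elim: s => [|i s IH] sF; first by rewrite big_nil; apply: zspan0.
rewrite big_cons; apply: zspanD; first exact/sF/mem_head.
by apply: IH => j js; apply: sF; rewrite inE js orbT.
Qed.

(** The additive step keeps the memberships because [linear_ext] and the antipode are only known to
    be additive on [WCQSym]. *)
Lemma zspan_ind (Q : V -> Prop) : Q 0 ->
    (forall x y, zspan A x -> zspan A y -> Q x -> Q y -> Q (x + y)) ->
    (forall x k, A x -> Q (x *~ k)) ->
  forall x, zspan A x -> Q x.
Proof.
move=> Q0 QD QA x /zspanP[s sA ->].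
suff [] : zspan A (\sum_(p <- s) p.1 *~ p.2) /\ Q (\sum_(p <- s) p.1 *~ p.2) by [].
elim: s sA => [|p s IH] sA; first by rewrite big_nil; split=> //; apply: zspan0.
have [Zs Qs] : zspan A (\sum_(p <- s) p.1 *~ p.2) /\ Q (\sum_(p <- s) p.1 *~ p.2).
  by apply: IH => q qs; apply: sA; rewrite inE qs orbT.
have Ap : A p.1 by apply/sA/mem_head.
have Zp : zspan A (p.1 *~ p.2) by apply/zspan_mulz/zspan_gen.
by rewrite big_cons; split; [apply: zspanD | apply: QD => //; apply: QA].
Qed.

End Span.

Lemma zspan_sub (V : zmodType) (A B : set V) :
  A `<=` zspan B -> zspan A `<=` zspan B.
Proof.
move=> AB; apply: zspan_ind; first exact: zspan0.
  by move=> x y _ _; apply: zspanD.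
by move=> x k /AB; apply: zspan_mulz.
Qed.

Lemma int_fun_mulz (T : Type) (f : T -> int) (k : int) x : (f *~ k) x = f x *~ k.
Proof.
have natE n : (f *+ n) x = f x *+ n.
  by elim: n => [|n IH] //; rewrite !mulrS -IH.
case: k => n; first exact: natE.
by rewrite NegzE !mulrNz -[LHS]/(- (f *+ n.+1) x) natE.
Qed.

Lemma series_mulz (f : series) (k : int) m : (f *~ k) m = f m *~ k.
Proof. exact: int_fun_mulz. Qed.

Lemma series2_mulz (f : series2) (k : int) p : (f *~ k) p = f p *~ k.
Proof. exact: int_fun_mulz. Qed.

Definition finite_coords (f : series) :=
  exists s : seq wcomp, forall al, al \notin s -> Defs.coord al f = 0.

(** Ensures that the sum defining [linear_ext] has finite support, hence that it is additive. *)
Lemma WCQSym_finite f : WCQSym f -> finite_coords f.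
Proof.
apply: zspan_ind; first by exists [::].
  move=> x y _ _ [s sx] [t ty]; exists (s ++ t) => al.
  rewrite mem_cat negb_or => /andP[als alt].
  by rewrite -[LHS]/(Defs.coord al x + Defs.coord al y) sx // ty // addr0.
move=> _ k [be _ <-]; exists [:: be] => al.
rewrite inE => /negPf al_be; rewrite /Defs.coord series_mulz -/(Defs.coord al (M be)).
by rewrite coord_M al_be mul0rz.
Qed.

Section LinearExt.

Variables (V : zmodType) (F : wcomp -> V).

Lemma linear_extE f (s : seq wcomp) : (forall al, al \notin s -> Defs.coord al f = 0) ->
  linear_ext F f = \sum_(al <- undup s) F al *~ Defs.coord al f.
Proof.
move=> sf; rewrite /linear_ext (fsbigE (undup s)) ?undup_uniq //.
  by apply: eq_bigl => al; rewrite in_setT.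
by move=> al _; rewrite mem_undup => /sf->; rewrite mulr0z.
Qed.

Lemma linear_extD f g : WCQSym f -> WCQSym g ->
  linear_ext F (f + g) = linear_ext F f + linear_ext F g.
Proof.
move=> /WCQSym_finite[s sf] /WCQSym_finite[t tg].
have sP al : al \notin s ++ t -> Defs.coord al f = 0.
  by rewrite mem_cat negb_or => /andP[/sf].
have tP al : al \notin s ++ t -> Defs.coord al g = 0.
  by rewrite mem_cat negb_or => /andP[_ /tg].
rewrite (linear_extE sP) (linear_extE tP) (@linear_extE _ (s ++ t)); last first.
  by move=> al al_st; rewrite -[LHS]/(Defs.coord al f + Defs.coord al g) sP // tP // addr0.
rewrite -big_split; apply: eq_bigr => al _.
by rewrite -[Defs.coord al (f + g)]/(Defs.coord al f + Defs.coord al g) mulrzDr.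
Qed.

Lemma linear_ext_mulz f k : WCQSym f -> linear_ext F (f *~ k) = linear_ext F f *~ k.
Proof.
move=> /WCQSym_finite[s sf]; rewrite (linear_extE sf) (@linear_extE _ s); last first.
  by move=> al /sf al_s; rewrite /Defs.coord series_mulz -/(Defs.coord al f) al_s mul0rz.
rewrite mulrz_suml; apply: eq_bigr => al _.
rewrite /Defs.coord series_mulz -/(Defs.coord al f).
by rewrite -mulrzA; congr (_ *~ _); rewrite -mulrzr intz.
Qed.

Lemma linear_ext0 : linear_ext F 0 = 0.
Proof. by rewrite (@linear_extE _ [::]) ?big_nil. Qed.

Lemma linear_ext_sum (T : eqType) (s : seq T) (G : T -> series) :
    (forall i, i \in s -> WCQSym (G i)) ->
  linear_ext F (\sum_(i <- s) G i) = \sum_(i <- s) linear_ext F (G i).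
Proof.
elim: s => [|i s IH] sG; first by rewrite !big_nil linear_ext0.
have sG' j : j \in s -> WCQSym (G j) by move=> js; apply: sG; rewrite inE js orbT.
rewrite !big_cons linear_extD ?IH //; first exact/sG/mem_head.
exact: zspan_sum.
Qed.

End LinearExt.

Lemma WCQSym_M al : WCQSym (M al).
Proof. by apply: zspan_gen; exists al. Qed.

(** * The coalgebra structure on the series of words *)

Lemma tens_mulzl f g k : tens (f *~ k) g = tens f g *~ k.
Proof.
by apply/funext => p; rewrite series2_mulz /tens series_mulz mulrzAl.
Qed.

Lemma tens_mulzr f g k : tens f (g *~ k) = tens f g *~ k.
Proof.
by apply/funext => p; rewrite series2_mulz /tens series_mulz mulrzAr.
Qed.

Lemma tens_suml (T : Type) (s : seq T) (F : T -> series) g :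
  tens (\sum_(i <- s) F i) g = \sum_(i <- s) tens (F i) g.
Proof.
elim: s => [|i s IH].
  by rewrite !big_nil; apply/funext => p; rewrite /tens mul0r.
rewrite !big_cons -IH; apply/funext => p.
by rewrite /tens mulrDl.
Qed.

Lemma tens_sumr (T : Type) (s : seq T) (F : T -> series) g :
  tens g (\sum_(i <- s) F i) = \sum_(i <- s) tens g (F i).
Proof.
elim: s => [|i s IH].
  by rewrite !big_nil; apply/funext => p; rewrite /tens mulr0.
rewrite !big_cons -IH; apply/funext => p.
by rewrite /tens mulrDr.
Qed.

Lemma sum_cuts_belast (L : Type) (V : nmodType) (F : seq L * seq L -> V) w :
  \sum_(p <- cuts w) F p =
  \sum_(p <- cuts w) (if nilp p.2 then 0 else F p) + F (w, [::]).
Proof.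
case/lastP: w => [|w a]; first by rewrite !big_seq1 /= add0r.
rewrite !sum_cuts_rcons /= addr0; congr (_ + _).
by apply: eq_bigr => p _; rewrite /nilp size_rcons.
Qed.

Section WordSeries.

Variables (L : eqType) (r : rel L) (ty : L -> bool).
Implicit Types w : seq L.

Let K := Kser r ty.

Lemma Kser_WCQSym w : WCQSym (K w).
Proof. by apply: zspan_sum => s _; apply/zspan_mulz/WCQSym_M. Qed.

(** [segm_coef] is multiplicative under concatenation, so cutting a factorization of [w] amounts to
    factorizing the two sides of a cut of [w], by [sum_segm_cuts]. *)
Lemma coprod_Kser w : coprod (K w) = \sum_(p <- cuts w) tens (K p.1) (K p.2).
Proof.
rewrite /K /Kser /coprod linear_ext_sum; last first.
  by move=> s _; apply/zspan_mulz/WCQSym_M.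
transitivity (\sum_(s <- segm w) \sum_(p <- cuts s)
   tens (M (contents ty p.1) *~ segm_coef r p.1) (M (contents ty p.2) *~ segm_coef r p.2)).
  apply: eq_bigr => s _; rewrite linear_ext_mulz ?linear_ext_M; last exact: WCQSym_M.
  rewrite cuts_iota big_map -/(index_iota 0 (size s).+1) big_mkord mulrz_suml size_map.
  apply: eq_bigr => i _ /=.
  rewrite tens_mulzl tens_mulzr -mulrzA /contents !map_take !map_drop.
  by rewrite [_ * segm_coef _ _]mulrC /segm_coef -big_cat cat_take_drop.
rewrite (sum_segm_cuts (fun s t => tens (M (contents ty s) *~ segm_coef r s)
  (M (contents ty t) *~ segm_coef r t))).
apply: eq_bigr => p _; rewrite tens_suml; apply: eq_bigr => s _.
by rewrite tens_sumr.
Qed.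

Lemma Kser_nil : K [::] = 1.
Proof.
apply: agree_eq => N; refine (agree_trans (agree_sym (Kvals_Kser _ _ _ (N := N))) _).
by rewrite Kvals_nil.
Qed.

Lemma counit_Kser w : counit (K w) = (nilp w)%:R.
Proof.
rewrite /K /Kser /counit linear_ext_sum; last by move=> s _; apply/zspan_mulz/WCQSym_M.
under eq_bigr => s _ do
  rewrite (linear_ext_mulz _ _ (WCQSym_M _)) linear_ext_M.
case: w => [|a w]; first by rewrite big_seq1 /segm_coef big_nil mulr1z.
rewrite sum_segm_cons big1 ?add0r; last by move=> s _; rewrite mul0rz.
by rewrite big1 // => -[|b s] _; rewrite ?mul0rz.
Qed.

(** Both [S (K w)] and the signed reversed series are left convolution inverses of [K]. They agree
    by induction on the length: the value at [w] enters only through the last cut, with coefficient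
    [K [::] = 1]. *)
Lemma antipode_Kser (S : series -> series) w : is_antipode S ->
  S (K w) = (-1) ^+ size w * Kser (dualr r) ty (rev w).
Proof.
move=> hS; have [n] := ubnP (size w); elim: n w => // n IH w wn.
pose D u : series := (-1) ^+ size u * Kser (dualr r) ty (rev u).
have conv_SD : \sum_(p <- cuts w) S (K p.1) * K p.2 = (nilp w)%:R.
  have SK := antipode_convl hS (f := K w) (n := size (cuts w))
    (a := fun i => K (tnth (in_tuple (cuts w)) i).1)
    (b := fun i => K (tnth (in_tuple (cuts w)) i).2) (Kser_WCQSym w)
    (fun i => Kser_WCQSym _) (fun i => Kser_WCQSym _).
  rewrite [LHS]big_tnth SK ?counit_Kser; first by case: (nilp w).
  by rewrite coprod_Kser [LHS]big_tnth.
have conv_D : \sum_(p <- cuts w) D p.1 * K p.2 = (nilp w)%:R.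
  apply: agree_eq => N.
  have := signed_rev_Kvals r ty (signed (iota 1 N)) w; rewrite /conv1 => <-.
  apply: agree_sum => p; apply: agree_sym; apply: agree_mul; last exact: Kvals_Kser.
  by apply: agree_mul; [apply: agree_refl | apply: Kvals_Kser].
have := etrans conv_SD (esym conv_D).
rewrite (sum_cuts_belast (fun p => S (K p.1) * K p.2)).
rewrite (sum_cuts_belast (fun p => D p.1 * K p.2)).
have -> : K (w, [::]).2 = 1 by apply: Kser_nil.
rewrite !mulr1.
have -> : \sum_(p <- cuts w) (if nilp p.2 then 0 else S (K p.1) * K p.2) =
          \sum_(p <- cuts w) (if nilp p.2 then 0 else D p.1 * K p.2).
  rewrite big_seq [RHS]big_seq; apply: eq_bigr => p /cuts_cat pw.
  case: ifP => // /negbT p2; have {}/IH-> // : (size p.1 < n)%N.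
  rewrite -ltnS; apply: leq_trans wn; rewrite pw size_cat ltnS -[leqLHS]addn0 ltn_add2l.
  by rewrite lt0n.
by move/addrI.
Qed.

Lemma Kser_mul u v : transitive r -> transitive (negr r) ->
    (forall x y, x != y -> r x y = ~~ r y x) -> disjoint_words u v ->
  K u * K v = \sum_(w <- shuffle u v) K w.
Proof.
move=> r_tr nr_tr r_tot duv; apply: agree_eq => N.
have uvN := agree_sym (agree_mul (Kvals_Kser r ty u (N := N)) (Kvals_Kser r ty v (N := N))).
refine (agree_trans uvN _); rewrite (shuffle_char_Kvals _ r_tr nr_tr r_tot) //.
by apply: agree_sum => w; apply: Kvals_Kser.
Qed.

End WordSeries.

(** * The words of the chains *)

(** Labels increase inside a positive block, but each such block has smaller labels than the
    previous one, so its first letter is marked as a descent. Labels of zero parts only increase. *)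
Definition block (a : nat) : seq letter :=
  if a is s.+1 then (true, true) :: nseq s (true, false) else [:: (false, false)].

Definition word (al : wcomp) : seq letter := flatten (map block al).

Section Junction.

Variables (T U : Type) (f : T -> T -> U).

Definition junction (u v : seq T) : seq U :=
  if u is x :: u' then if v is y :: _ then [:: f (last x u') y] else [::] else [::].

Lemma links_junction u v : links f (u ++ v) = links f u ++ junction u v ++ links f v.
Proof.
case: u => [|x u] //; case: v => [|y v]; first by rewrite !cats0.
by rewrite /= pairmap_cat.
Qed.

Lemma links_nseq n x : links f (nseq n x) = nseq n.-1 (f x x).
Proof. by case: n => // n; elim: n => //= n ->. Qed.

Lemma links_cons_nseq n x y : links f (x :: nseq n.+1 y) = f x y :: nseq n (f y y).
Proof. by rewrite links_cons -[y :: _]/(nseq n.+1 y) links_nseq. Qed.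

End Junction.

Lemma last_nseq (T : Type) n (x : T) : last x (nseq n x) = x.
Proof. by elim: n => //= n IH. Qed.

Lemma links_block_cons s d :
  links asc ((true, d) :: nseq s (true, false)) = nseq s true.
Proof. by case: s => // s; rewrite links_cons_nseq. Qed.

Lemma last_type (n : nat) (x y : letter) : ltype x -> ltype y ->
  ltype (last x (nseq n y)).
Proof. by move=> tx ty; case: n => //= n; rewrite last_nseq. Qed.

Lemma size_word al : size (word al) = wnorm al.
Proof.
rewrite /wnorm /num_zeros; elim: al => // -[|a] al IH.
  by rewrite /= -/(word al) IH addnCA.
by rewrite [word _]/= -/(word al) size_cat IH /= size_nseq add0n addnA.
Qed.

Lemma word_no_zD al : ((false, true) : letter) \notin word al.
Proof.
apply/flattenP => -[_ /mapP[[|a] _ ->]] //.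
by rewrite /= inE => /nseqP[].
Qed.

Section ChainLabels.

Variable z : nat.

(** The bound on [c] keeps the labels of zero parts at most [z], below those of all positive blocks;
    the first clause records both ranges for the induction. *)
Lemma chain_labelsP c al : (c + num_zeros al <= z.+1)%N ->
  let s := chain_labels z c al in
  [/\ (forall x, x \in s -> (c <= x < c + num_zeros al) || (z < x <= z + sumn al))%N,
      uniq s, map (fun x => z < x)%N s = map ltype (word al) &
      links ltn s = links asc (word al)].
Proof.
elim: al c => [|a al IH] c //.
have nzE : num_zeros (a :: al) = ((a == 0) + num_zeros al)%N by [].
move: nzE; case: a => [|a] ->.
  rewrite [(_ == _ : nat)]/= addnA addn1 => cz; have [s_mem s_uniq s_type s_links] := IH c.+1 cz.
  split.
  - move=> x; rewrite inE => /orP[/eqP->|/s_mem]; first by lia.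
    by rewrite /=; lia.
  - by rewrite /= s_uniq andbT; apply/negP => /s_mem; lia.
  - by rewrite /= -/(word al) s_type; congr (_ :: _); lia.
  rewrite /= -/(word al); case: al cz {IH s_mem s_uniq s_type} s_links => [|[|b] al] // cz s_links.
    by rewrite [LHS]links_cons s_links /= ltnSn.
  rewrite [LHS]links_cons s_links [RHS]links_cons; congr (_ :: _).
  by rewrite /asc /=; lia.
rewrite [(_ == _ : nat)]/= add0n => cz; have [s_mem s_uniq s_type s_links] := IH c cz.
split.
- move=> x; rewrite inE mem_cat mem_iota => /or3P[/eqP->||/s_mem] /=; lia.
- rewrite /= cat_uniq s_uniq iota_uniq mem_cat mem_iota ltnn /= andbT.
  apply/andP; split; first by apply/negP => /s_mem; lia.
  by apply/hasPn => x /s_mem; rewrite /= mem_iota; lia.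
- rewrite /= -/(word al) !map_cat s_type; congr (_ :: _ ++ _); first by lia.
  apply: (@eq_from_nth _ true); rewrite !size_map size_iota ?size_nseq // => i ia.
  rewrite (nth_map 0%N) ?size_iota // nth_iota // (nth_map (true, true)) ?size_nseq //.
  by rewrite nth_nseq ia /ltype /=; lia.
have iotaE : forall m n, links ltn (m :: iota m.+1 n) = nseq n true.
  by move=> m n; elim: n m => // n IHn m; rewrite /= ltnSn; congr (_ :: _); apply: IHn.
rewrite -[chain_labels _ _ _]/(((z + sumn al).+1 :: iota (z + sumn al).+2 a) ++ chain_labels z c al).
rewrite -[word (_ :: _)]/(((true, true) :: nseq a (true, false)) ++ word al).
rewrite !links_junction s_links iotaE links_block_cons.
congr (_ ++ (_ ++ _)).
(* The last label of a block exceeds every label still to come, so the chain descends after it. *)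
have lastE : last (z + sumn al).+1 (iota (z + sumn al).+2 a) = (z + sumn al + a).+1.
  by elim: a (z + sumn al)%N {cz} => [|a IHa] m /=; rewrite ?addn0 // IHa addSnnS.
have tl : ltype (last (true, true) (nseq a (true, false))) by apply: last_type.
case: al cz {IH s_mem s_uniq s_type s_links iotaE} lastE => [|[|b] al] // cz lastE.
  rewrite [LHS]/= lastE [RHS]/= /asc [_.1]tl /=; congr (_ :: _).
  by move: cz => /=; lia.
rewrite [LHS]/= lastE [RHS]/= /asc [_.1]tl /=; congr (_ :: _).
by lia.
Qed.

End ChainLabels.

Lemma chainP al :
  [/\ uniq (chain al), map (fun x => num_zeros al < x)%N (chain al) = map ltype (word al) &
      links ltn (chain al) = links asc (word al)].
Proof. by have [] := @chain_labelsP (num_zeros al) 1 al (leqnn _). Qed.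

Lemma K_chain al : K al = Kser ltn (fun x => num_zeros al < x)%N (chain al).
Proof.
have [u _ _] := chainP al; rewrite /K Lambda_Kser //; apply: Kser_links => //.
by apply/eq_in_map => x xs; rewrite !inE xs.
Qed.

Lemma K_word al : K al = Kword (word al).
Proof.
by have [_ t l] := chainP al; rewrite K_chain; apply: Kser_links.
Qed.

(** * Deconcatenation *)

(** An enumeration of [bar_split al]: a first part [a] splits into two positive parts in [a.-1]
    ways, which are the near concatenations. *)
Fixpoint bar_splits (al : wcomp) : seq (wcomp * wcomp) :=
  ([::], al) ::
  match al with
  | [::] => [::]
  | a :: al' =>
      [seq ([:: j.+1], (a.-1 - j)%N :: al') | j <- iota 0 a.-1] ++
      [seq (a :: p.1, p.2) | p <- bar_splits al']
  end.

Lemma sum_bar_splits (V : nmodType) (F : seq letter -> series -> V) al :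
  \sum_(p <- cuts (word al)) F p.1 (Kword p.2) =
  \sum_(q <- bar_splits al) F (word q.1) (K q.2).
Proof.
elim: al F => [|a al IH] F; first by rewrite !big_seq1 K_word.
rewrite [bar_splits _]/= big_cons big_cat !big_map /= K_word.
case: a => [|a].
  rewrite -[word (0%N :: al)]/((false, false) :: word al) sum_cuts_cons big_nil add0r; congr (_ + _).
  exact: (IH (fun u => F ((false, false) :: u))).
rewrite -[word (a.+1 :: al)]/((true, true) :: nseq a (true, false) ++ word al) sum_cuts_cons; congr (_ + _).
suff run n G : \sum_(p <- cuts (nseq n (true, false) ++ word al)) G p.1 (Kword p.2) =
    \sum_(j <- iota 0 n) G (nseq j (true, false)) (K ((n - j)%N :: al)) +
    \sum_(q <- bar_splits al) G (nseq n (true, false) ++ word q.1) (K q.2) :> V.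
  by rewrite (run a (fun u => F ((true, true) :: u))); congr (_ + _);
    apply: eq_bigr => j _; rewrite /word /= cats0.
elim: n G => [|n IHn] G; first by rewrite big_nil add0r IH.
have -> : iota 0 n.+1 = 0%N :: map S (iota 0 n) by rewrite /= (iotaDl 1 0).
rewrite cat_cons sum_cuts_cons big_cons big_map -addrA; congr (_ + _).
  congr (G _ _); rewrite K_word; apply: Kser_links => //.
  by rewrite /word /=; case: (nseq n _ ++ _).
exact: (IHn (fun u => G ((true, false) :: u))).
Qed.

Lemma nearcat_cons b c p q : nearcat (b :: c :: p) q = b :: nearcat (c :: p) q.
Proof. by []. Qed.

Lemma mem_bar_splits al p : (p \in bar_splits al) <-> bar_split al p.
Proof.
elim: al p => [|a al IH] [p q].
  rewrite inE /bar_split /=; split=> [/eqP[-> ->]|]; first by left.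
  by case=> [|[]]; case: p => [|b [|c p]] //; case: q.
have consP (p' q' : wcomp) : bar_split al (p', q') ->
    (a :: p', q') \in [seq (a :: p.1, p.2) | p <- bar_splits al].
  by move=> /IH pq; apply/mapP; exists (p', q').
rewrite [bar_splits _]/= inE mem_cat; split.
  case/or3P=> [/eqP[-> ->]|/mapP[j + [-> ->]]|/mapP[[p' q'] + [-> ->]]].
  - by left.
  - rewrite mem_iota => /andP[_ ja]; right; split=> //=; rewrite /nearcat /=; first by lia.
    by congr (_ :: _); lia.
  - case/IH => [/= <-|[/= p0 q0 E]]; first by left.
    by right; rewrite /=; case: p' p0 E => // b p' p0 E; rewrite nearcat_cons E.
case=> [/=|[/= p0 q0]].
  case: p => [/= ->|b p /= [-> E]]; first by rewrite eqxx.
  by rewrite consP ?orbT //; left.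
case: p p0 => [|b [|c p]] // p0.
  case: q q0 => [|d q] //= q0 [E ->].
  have -> : ([:: b], d :: al) \in [seq ([:: j.+1], (a.-1 - j)%N :: al) | j <- iota 0 a.-1].
    apply/mapP; exists b.-1; first by rewrite mem_iota; move: p0 q0 E => /=; lia.
    by congr (_ :: _, _ :: _); move: p0 q0 E => /=; lia.
  by [].
rewrite nearcat_cons => -[-> E].
by rewrite consP ?orbT //; right.
Qed.

Lemma bar_splits_uniq al : uniq (bar_splits al).
Proof.
elim: al => // a al IH; rewrite [bar_splits _]/= cons_uniq cat_uniq; apply/and4P; split.
- by rewrite mem_cat negb_or; apply/andP; split; apply/mapP => -[].
- by rewrite map_inj_uniq ?iota_uniq // => i j [].
- apply/hasPn => _ /mapP[[p q] pq ->]; apply/mapP => -[j]; rewrite mem_iota => ja [E Ep Eq].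
  by move: pq; rewrite Ep Eq => /mem_bar_splits [/=|[]] // /(congr1 size) /=; lia.
- by rewrite map_inj_uniq // => -[? ?] [? ?] [-> ->].
Qed.

Lemma coprod_K al : coprod (K al) = \sum_(p \in bar_split al) tens (K p.1) (K p.2).
Proof.
rewrite (fsbigE (bar_splits al)); first 1 last.
- exact: bar_splits_uniq.
- by move=> p; apply: (mem_bar_splits al p).1.
- by move=> p /mem_bar_splits->.
rewrite [in LHS]K_word coprod_Kser.
rewrite (@sum_bar_splits _ (fun u f => tens (Kword u) f)).
rewrite big_seq [RHS]big_seq_cond; apply: eq_big => p.
  have [pb|] := boolP (p \in bar_splits al); last by [].
  by rewrite /= mem_set //; apply/mem_bar_splits.
by move=> _; rewrite [K p.1]K_word.
Qed.

(** * Transposition *)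

(** The ones replacing the part [a] in the complement: descents separate them, and the initial
    ascent merges the block with a preceding positive one. *)
Definition cblock (a : nat) : seq letter :=
  if a is s.+1 then (true, false) :: nseq s (true, true) else [:: (false, false)].

(** The reverse of [block a]: the flag of a letter now describes its link with the next letter. *)
Definition rblock (a : nat) : seq letter :=
  if a is s.+1 then rcons (nseq s (true, false)) (true, true) else [:: (false, false)].

Definition cword (al : wcomp) := flatten (map cblock al).

Definition rword (al : wcomp) := flatten (map rblock al).

(* Differs from [dualr asc] only between two letters of exponent 0, where it is
   an ascent rather than a descent; as such a pair always follows a descent and
   precedes an ascent, no peak changes. *)
Definition rasc (x y : letter) : bool := if x.1 && y.1 then x.2 else y.1 || ~~ x.1.

Lemma rev_word al : rev (word al) = rword (rev al).
Proof.
rewrite /word rev_flatten -map_comp -map_rev; congr flatten.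
by apply: eq_map => -[|a] //=; rewrite rev_cons rev_nseq.
Qed.

Lemma peaks_rasc w : ((false, true) : letter) \notin w ->
  peaks (dualr asc) w = peaks rasc w.
Proof.
elim: w => // x [|y [|z w]] IH // w0.
have {IH} IHw : peaks (dualr asc) [:: y, z & w] = peaks rasc [:: y, z & w].
  by apply: IH; move: w0; rewrite inE negb_or => /andP[].
rewrite -[LHS]/((dualr asc x y && ~~ dualr asc y z) :: peaks (dualr asc) [:: y, z & w]).
rewrite -[RHS]/((rasc x y && ~~ rasc y z) :: peaks rasc [:: y, z & w]) IHw.
congr (_ :: _); move: w0; rewrite !inE !negb_or {IHw}.
by case: x => [[] []]; case: y => [[] []]; case: z => [[] []].
Qed.

Lemma cword_no_zD al : ((false, true) : letter) \notin cword al.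
Proof.
apply/flattenP => -[_ /mapP[[|a] _ ->]] //.
by rewrite /= inE => /nseqP[].
Qed.

Lemma asc_zA (y : letter) V : ((false, true) : letter) \notin y :: V -> asc (false, false) y.
Proof. by rewrite inE negb_or => /andP[]; case: y => [[] []]. Qed.

(** Moves the flag from the left letter of a pair, where reversal puts it and [rasc] reads it, to
    the right one, where [asc] reads it. *)
Lemma rword_cword al : map ltype (rword al) = map ltype (cword al) /\
  links rasc (rword al) = links asc (cword al).
Proof.
elim: al => // a al [IHt IHl].
rewrite -[rword (a :: al)]/(rblock a ++ rword al) -[cword (a :: al)]/(cblock a ++ cword al).
rewrite !map_cat IHt !links_junction IHl; split.
  congr (_ ++ _); case: a => // a; rewrite /= map_rcons !map_nseq -cats1.
  by rewrite -[[:: _]]/(nseq 1 true) -nseqD addn1.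
congr (_ ++ (_ ++ _)).
  case: a => // -[|a] //; rewrite [RHS]links_cons_nseq [asc _ _]/=.
  elim: a => // a IHa.
  by rewrite -[rblock _]/((true, false) :: rblock a.+2) links_cons IHa.
have rl x : last x (rblock a) = if a is 0 then (false, false) else (true, true).
  by case: (a) => // n; rewrite /= last_rcons.
have cl x : ltype (last x (cblock a)) = (a != 0)%N.
  by case: (a) => // n; rewrite /= last_type.
have rn : rblock a <> [::] by case: (a) => // -[].
have cn : cblock a <> [::] by case: (a).
have cnz := cword_no_zD al.
case: (rblock a) rl rn => // x0 u rl _; case: (cblock a) cl cn => // y0 v cl _.
have {rl} rl : last x0 u = if a is 0 then (false, false) else (true, true) by apply: (rl x0).
have {cl} cl : ltype (last y0 v) = (a != 0)%N by apply: (cl y0).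
case: (rword al) IHt => [|x w]; first by case: (cword al).
move=> IHt; rewrite /= rl; case: {IHl} al IHt cnz => // b al.
have -> : cword (b :: al) = (0 < b, false)%N :: behead (cblock b) ++ cword al by case: b.
move=> [tx _] _; congr (_ :: _); rewrite /asc [_.1]cl /rasc -/(ltype x) tx.
by case: a {x0 u rl y0 v cl} => [|a]; case: b {tx}.
Qed.

Lemma word_cat al be : word (al ++ be) = word al ++ word be.
Proof. by rewrite /word map_cat flatten_cat. Qed.

Lemma word_wcompl al : map ltype (word (wcompl al)) = map ltype (cword al) /\
  links asc (word (wcompl al)) = links asc (cword al).
Proof.
(* The next complement starts with a positive part, into which near concatenation can merge. *)
have head_wcompl be : (0 < head 0 be)%N -> exists h t, wcompl be = h.+1 :: t.
  case: be => // -[|b] be // _ /=; case: ifP => _; last by exists 0%N, (nseq b 1%N ++ wcompl be).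
  by case: b => [|b]; [exists (head 0 (wcompl be)), (behead (wcompl be)) |
    exists 0%N, (behead (nearcat (nseq b.+2 1%N) (wcompl be)))].
elim: al => // a al [IHt IHl].
case: a => [|a].
  rewrite -[word _]/((false, false) :: word (wcompl al)).
  rewrite -[cword _]/((false, false) :: cword al) -![_ :: word _]cat1s -![_ :: cword _]cat1s.
  rewrite !map_cat IHt !links_junction IHl; split=> //; congr (_ ++ (_ ++ _)).
  have := word_no_zD (wcompl al); have := cword_no_zD al.
  case: (word _) IHt => [|x u]; case: (cword al) => [|y v] // _ /asc_zA hy /asc_zA hx.
  by rewrite /= hx hy.
have wones n : word (nseq n 1%N) = nseq n (true, true) by elim: n => //= n; rewrite /word /= => ->.
rewrite -[cword _]/(((true, false) :: nseq a (true, true)) ++ cword al).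
have clast : ltype (last (true, false) (nseq a (true, true))) by apply: last_type.
have cl1 : links asc ((true, false) :: nseq a (true, true)) = nseq a false.
  by case: (a) => // n; rewrite links_cons_nseq.
have wl1 : links asc (nseq a.+1 (true, true)) = nseq a false by rewrite links_nseq.
have junctionE y v u : junction asc ((true, false) :: nseq a (true, true)) ((y : letter) :: v) =
    junction asc (nseq a.+1 (true, true)) (y :: u).
  by rewrite /= last_nseq /asc [_.1]clast.
rewrite [wcompl _]/=; case: ifP => [al0|al0].
  have [h [t wE]] := head_wcompl _ al0.
  have -> : word (nearcat (1%N :: nseq a 1%N) (wcompl al)) =
      nseq a.+1 (true, true) ++ (true, false) :: nseq h (true, false) ++ word t.
    rewrite wE /nearcat /= -/(nseq a.+1 1%N) size_nseq.
    have -> : take a (1%N :: nseq a 1%N) = nseq a 1%N.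
      by rewrite -[_ :: _]/(nseq a.+1 1%N) take_nseq.
    rewrite last_nseq word_cat wones /=.
    by elim: (a) => //= n ->.
  move: IHt IHl; rewrite wE -[word _]/((true, true) :: nseq h (true, false) ++ word t).
  set W := nseq h _ ++ _.
  case: al al0 {wE} => // -[|b] al // _.
  rewrite -[cword _]/((true, false) :: nseq b (true, true) ++ cword al); set C := _ ++ _ => IHt IHl.
  rewrite !map_cat !links_junction cl1 wl1 (junctionE _ _ W); split.
    by congr (_ ++ _); apply: IHt.
  (* Merging changes only the flag of the first letter of the second word, which its inner links do
     not read. *)
  have -> : links asc ((true, false) :: W) = links asc ((true, true) :: W) by case: (W).
  by rewrite IHl.
rewrite -[1%N :: _]/(nseq a.+1 1%N ++ wcompl al) word_cat wones !map_cat IHt !links_junction IHl cl1 wl1.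
split; first by rewrite /= !map_nseq.
congr (_ ++ (_ ++ _)).
case: al al0 {IHt IHl} => // -[|b] al // _.
by rewrite -[wcompl _]/(0%N :: wcompl al); apply/esym; apply: junctionE.
Qed.

Lemma Kser_transp al : Kser (dualr asc) ltype (rev (word al)) = K (wtransp al).
Proof.
have [t1 l1] := rword_cword (rev al); have [t2 l2] := word_wcompl (rev al).
rewrite K_word /wtransp rev_word; transitivity (Kser rasc ltype (rword (rev al))).
  apply: Kser_peaks => //; apply: peaks_rasc.
  by rewrite -rev_word mem_rev word_no_zD.
by apply: Kser_links; rewrite ?t1 ?t2 ?l1 ?l2.
Qed.

(** * The span of the series of words *)

(** The composition is built from the right: a letter of exponent 1 followed by [(true, false)]
    enlarges the first part, any other letter starts a new part. *)
Lemma word_exists (V : seq letter) : ((false, true) : letter) \notin V ->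
  exists al, map ltype V = map ltype (word al) /\ links asc V = links asc (word al).
Proof.
elim: V => [|x V IH] nxV; first by exists [::].
have nV : ((false, true) : letter) \notin V.
  by move: nxV; rewrite inE negb_or => /andP[].
have [al [tE lE]] := IH nV; case: V nV nxV tE lE {IH} => [|y V] nV nxV tE lE.
  by case: x nxV => [[] []] //; (exists [:: 1%N]) + (exists [:: 0%N]).
have := word_no_zD al; case wE: (word al) tE lE => [|z w] // tE lE nz.
have [x1|x0] := boolP x.1; last first.
  have xE : x = (false, false) by case: x x0 nxV => [[] []].
  exists (0%N :: al); rewrite -[word _]/((false, false) :: word al) wE xE.
  by split; [rewrite [LHS]map_cons tE | rewrite !links_cons (asc_zA nV) (asc_zA nz) lE].
have [yE|yN] := eqVneq y (true, false).
  case: al wE => // -[|s] al; first by move=> [zE _]; move: tE; rewrite -zE yE.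
  move=> [zE wE]; exists (s.+2 :: al).
  rewrite -[word _]/[:: (true, true), (true, false) & nseq s (true, false) ++ word al] wE.
  have wl : links asc ((true, false) :: w) = links asc (z :: w) by rewrite -zE; case: (w).
  split; last by rewrite !links_cons wl lE yE [asc x _]/asc x1.
  by rewrite [LHS]map_cons tE -zE [in LHS]/ltype x1.
exists (1%N :: al); rewrite -[word _]/((true, true) :: word al) wE !links_cons lE.
split; first by rewrite [LHS]map_cons tE [in LHS]/ltype x1.
congr (_ :: _).
have [tyz _] : ltype y = ltype z /\ True by case: tE.
case: al wE {lE tE nz} => // -[|s] al [zE _]; move: tyz yN; rewrite -zE /asc x1.
  by case: y {nV nxV} => [[] []].
by case: y {nV nxV} => [[] []].
Qed.

(** [V] holds the letters already known to differ from [(false, true)], and the induction is on the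
    length of [U]; each rewriting removes the last such descent. *)
Lemma WPQSym_Kword (w : seq letter) : WPQSym (Kword w).
Proof.
suff main n U V : (size U < n)%N -> ((false, true) : letter) \notin V -> WPQSym (Kword (U ++ V)).
  by rewrite -[w]cats0; apply: main (ltnSn _) _.
elim: n U V => // n IH U V; case/lastP: U => [_ nV|U x].
  have [al [tE lE]] := word_exists nV.
  by apply: zspan_gen; exists al; rewrite ?K_word //; apply/esym/Kser_links.
rewrite size_rcons ltnS cat_rcons => Un nV.
have [xE|xN] := eqVneq x (false, true); last first.
  by apply: IH => //; rewrite inE eq_sym negb_or xN.
have nV0 : ((false, true) : letter) \notin (false, false) :: V by rewrite inE.
have WzA : WPQSym (Kword (U ++ (false, false) :: V)) by apply: IH.
(* With nothing before it, or after a letter of exponent 1, the flag of [x] affects no link. *)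
case/lastP: U Un WzA => [|U y] Un WzA.
  rewrite (_ : Kword _ = Kword ([::] ++ (false, false) :: V)) //.
  by apply: Kser_links; rewrite xE //; case: (V).
move: Un WzA; rewrite size_rcons cat_rcons => Un WzA; rewrite cat_rcons xE.
have [y1|y0] := boolP (ltype y).
  rewrite (_ : Kword _ = Kword (U ++ [:: y, (false, false) & V])) //.
  apply: Kser_links; first by rewrite !map_cat.
  have yz d : asc y (false, d) = false by rewrite /asc [y.1]y1.
  rewrite -!(cat_rcons y) !links_cat !yz; congr (_ ++ _ :: _).
  by case: (V).
have ty : ltype y = false by apply: negbTE.
(* [Kword_zD_first] applies unless an ascent leads to [y]; in that case [t] and [y] both have
   exponent 0. *)
case/lastP: U Un WzA => [|U t] Un WzA.
  by rewrite Kword_zD_first // => ? [|? ?].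
have [ascty|ascty] := boolP (asc t y); last first.
  rewrite Kword_zD_first // => u U' /rcons_inj[_ <-]; exact: negbTE.
have tE : ltype t = false.
  by move: ascty; rewrite /asc -/(ltype t) -/(ltype y) ty; case: (ltype t).
have yE : y = (false, false).
  by move: ascty ty; rewrite /asc -/(ltype t) tE; case: (y) => [[] []].
move: WzA; rewrite !cat_rcons yE Kword_zD_second // => WzA.
apply: zspanB => //; rewrite -cat_rcons; apply: IH => //.
by rewrite size_rcons; move: Un; rewrite size_rcons; apply: leq_trans.
Qed.

(** * Products *)

Definition label : Type := (bool * nat)%type.

(** Labels of exponent 0 lie below those of exponent 1, as in every chain, so shuffles of two chains
    follow the convention of [asc]. *)
Definition label_lt (x y : label) : bool := if x.1 == y.1 then (x.2 < y.2)%N else y.1.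

Lemma label_lt_trans : transitive label_lt.
Proof.
by move=> [[] y] [[] x] [[] z] //=; rewrite /label_lt /=; apply: ltn_trans.
Qed.

Lemma label_ge_trans : transitive (negr label_lt).
Proof.
move=> [[] y] [[] x] [[] z] //=; rewrite /negr /label_lt /= -?leqNgt // => yx zy;
  exact: leq_trans zy yx.
Qed.

Lemma label_lt_total x y : x != y -> label_lt x y = ~~ label_lt y x.
Proof.
case: x y => [[] x] [[] y] //; rewrite /label_lt /= -leqNgt xpair_eqE /=;
  by case: ltngtP.
Qed.

Lemma WPQSym_labels (w : seq label) : WPQSym (Kser label_lt fst w).
Proof.
case: w => [|x w].
  rewrite (_ : Kser _ _ _ = Kword [::]); first exact: WPQSym_Kword.
  by apply: Kser_links.
(* Each letter records whether a descent leads to it; the first flag is arbitrary. *)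
pose V : seq letter := (x.1, false) :: pairmap (fun a b => (b.1, ~~ label_lt a b)) x w.
rewrite (_ : Kser _ _ _ = Kword V); first exact: WPQSym_Kword.
apply: Kser_links; rewrite /V /=.
  by congr (_ :: _); elim: w x {V} => //= y w IH x; rewrite (IH y).
elim: w (x) (false) {V} => // y w IH {}x d; rewrite [LHS]/= [RHS]/= -IH; congr (_ :: _).
by rewrite /asc /label_lt /= negbK; case: ifP.
Qed.

Definition labels (k : nat) (al : wcomp) : seq label :=
  [seq (num_zeros al < x, x + k)%N | x <- chain al].

Lemma K_labels k al : K al = Kser label_lt fst (labels k al).
Proof.
rewrite K_chain; apply: Kser_links; first by rewrite /labels -map_comp.
rewrite /labels links_map; congr (links _ _); apply/funext => x; apply/funext => y.
rewrite /label_lt /= ltn_add2r; case: eqP => // xy; lia.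
Qed.

Lemma WPQSym_KM al be : WPQSym (K al * K be).
Proof.
(* The shift exceeds every label of [chain al], which makes the two words disjoint. *)
pose k := (sumn (chain al)).+1.
rewrite (K_labels 0 al) (K_labels k be) Kser_mul; first 1 last.
- exact: label_lt_trans.
- exact: label_ge_trans.
- exact: label_lt_total.
- apply/allP => _ /mapP[x xs ->]; apply/negP => /mapP[y _ [_]].
  have : (x <= sumn (chain al))%N.
    by elim: (chain al) xs => //= z s IH; rewrite inE => /orP[/eqP->|/IH]; lia.
  by rewrite /k; lia.
by apply: zspan_sum => w _; apply: WPQSym_labels.
Qed.

Lemma WPQSym_sub : WPQSym `<=` WCQSym.
Proof. by apply: zspan_sub => _ [al _ <-]; rewrite K_word; apply: Kser_WCQSym. Qed.

(** * Additivity of the antipode and its values *)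

Section AntipodeAdditive.

Variables (S : series -> series) (hS : is_antipode S).

Lemma antipode0 : S 0 = 0.
Proof. by have := antipodeB hS (zspan0 _) (zspan0 _); rewrite !subrr. Qed.

Lemma antipodeN f : WCQSym f -> S (- f) = - S f.
Proof.
by move=> Wf; have := antipodeB hS (zspan0 _) Wf; rewrite antipode0 !sub0r.
Qed.

Lemma antipodeD f g : WCQSym f -> WCQSym g -> S (f + g) = S f + S g.
Proof.
move=> Wf Wg; have WNg : WCQSym (- g) by rewrite -mulrN1z; apply: zspan_mulz.
by have := antipodeB hS Wf WNg; rewrite antipodeN // !opprK.
Qed.

Lemma antipode_mulz f k : WCQSym f -> S (f *~ k) = S f *~ k.
Proof.
move=> Wf; have natE n : S (f *+ n) = S f *+ n.
  elim: n => [|n IH]; first exact: antipode0.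
  by rewrite !mulrS antipodeD ?IH // pmulrn; apply: zspan_mulz.
case: k => n; first exact: natE.
rewrite NegzE !mulrNz antipodeN; last exact: zspan_mulz.
by congr (- _); apply: natE.
Qed.

Lemma antipode_K al : S (K al) = (-1) ^+ wnorm al * K (wtransp al).
Proof.
by rewrite K_word (antipode_Kser _ _ _ hS) size_word Kser_transp.
Qed.

End AntipodeAdditive.

Theorem theorem4p2 (S : series -> series) (hS : is_antipode S) :
  hopf_subalgebra S WPQSym /\
  (forall al : wcomp,
     [/\ coprod (K al) = \sum_(p \in bar_split al) tens (K p.1) (K p.2),
         counit (K al) = (al == [::])%:R &
         S (K al) = (-1) ^+ wnorm al * K (wtransp al)]).
Proof.
split; last first.
  move=> al; split; [exact: coprod_K | | exact: antipode_K].
  rewrite K_word counit_Kser /nilp size_word; congr (_%:R : int).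
  (* Zero parts count in [wnorm], so it vanishes only on the empty composition. *)
  by case: al => // -[|a] al; rewrite /wnorm /num_zeros /=; lia.
split.
- exact: WPQSym_sub.
- by apply: zspan_gen; exists [::]; rewrite // K_word; apply: Kser_nil.
- by move=> f g; apply: zspanB.
- move=> f g Wf; move: g; apply: zspan_ind.
  + by rewrite mulr0; apply: zspan0.
  + by move=> x y _ _ Wx Wy; rewrite mulrDr; apply: zspanD.
  move=> _ k [be _ <-]; rewrite mulrzAr; apply: zspan_mulz; move: f Wf; apply: zspan_ind.
  + by rewrite mul0r; apply: zspan0.
  + by move=> x y _ _ Wx Wy; rewrite mulrDl; apply: zspanD.
  by move=> _ j [al _ <-]; rewrite mulrzAl; apply/zspan_mulz/WPQSym_KM.
- apply: zspan_ind.
  + by rewrite /coprod linear_ext0; apply: zspan0.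
  + move=> x y /WPQSym_sub Wx /WPQSym_sub Wy Tx Ty.
    by rewrite /coprod linear_extD //; apply: zspanD.
  move=> _ k [al _ <-]; rewrite K_word /coprod linear_ext_mulz; last exact: Kser_WCQSym.
  apply: zspan_mulz; rewrite -/(coprod _) coprod_Kser; apply: zspan_sum => p _.
  apply: zspan_gen; exists (Kword p.1), (Kword p.2).
  by split; [exact: WPQSym_Kword | exact: WPQSym_Kword |].
apply: zspan_ind.
- by rewrite antipode0 //; apply: zspan0.
- move=> x y /WPQSym_sub Wx /WPQSym_sub Wy WSx WSy.
  by rewrite antipodeD //; apply: zspanD.
move=> _ k [al _ <-]; rewrite antipode_mulz //; last by rewrite K_word; apply: Kser_WCQSym.
rewrite antipode_K //; apply: zspan_mulz; rewrite -signr_odd.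
have WK : WPQSym (K (wtransp al)) by apply: zspan_gen; exists (wtransp al).
by case: (odd _); rewrite ?expr1 ?expr0 ?mul1r // mulN1r -mulrN1z; apply: zspan_mulz.
Qed.
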